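(* Let $\Omega\subset\mathbb{R}^n$ be a bounded domain, $f\in C(\partial\Omega)$, and let $D\subset\Omega$ satisfy $\overline{\operatorname{int}D}=\overline D$. Then the problem $$\min\{\Delta_\infty u,\ |Du|-\chi_D\}=0\ \text{ in }\Omega,\qquad u=f\ \text{ on }\partial\Omega,$$ has a unique viscosity solution.
   Context: $\Delta_\infty u(x)=\sum_{i,j=1}^n u_{ij}(x)u_i(x)u_j(x)$ is the infinity Laplacian, $\chi_E$ is the characteristic function of a set $E$, and $\operatorname{int}D$, $\overline D$ are the topological interior and closure of $D$. The condition $u=f$ on $\partial\Omega$ means $\lim_{x\to z}u(x)=f(z)$ for all $z\in\partial\Omega$. An upper semicontinuous $u:\Omega\to\mathbb{R}$ is a viscosity subsolution of $\min\{\Delta_\infty u,|Du|-\chi_D\}=0$ in $\Omega$ if, whenever $x\in\Omega$ and $\varphi\in C^2(\Omega)$ are such that $u-\varphi$ has a strict local maximum at $x$, then $\min\{\Delta_\infty\varphi(x),|D\varphi(x)|-\chi_{\operatorname{int}D}(x)\}\ge 0$. A lower semicontinuous $v:\Omega\to\mathbb{R}$ is a viscosity supersolution if, whenever $x\in\Omega$ and $\phi\in C^2(\Omega)$ are such that $v-\phi$ has a strict local minimum at $x$, then $\min\{\Delta_\infty\phi(x),|D\phi(x)|-\chi_{\overline D}(x)\}\le 0$. A continuous function on $\Omega$ is a viscosity solution of the equation if it is both a viscosity subsolution and a viscosity supersolution. *)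

(* Defs.v *)
From HB Require Import structures.
From mathcomp Require Import all_boot all_order all_algebra.
From mathcomp Require Import all_classical all_reals all_analysis.

Set Implicit Arguments.
Unset Strict Implicit.
Unset Printing Implicit Defensive.
Import Order.TTheory GRing.Theory Num.Theory.
Import numFieldNormedType.Exports.

Local Open Scope classical_set_scope.
Local Open Scope ring_scope.

(* R^n is 'rV[R]_n. Its library norm is the sup norm, which gives the usual
   topology and the usual bounded sets; |Du| needs the Euclidean norm. *)
Definition enorm (R : realType) (n : nat) (v : 'rV[R]_n) : R :=
  Num.sqrt (\sum_(i < n) v ord0 i ^+ 2).

Definition bounded_domain (R : realType) (n : nat) (Omega : set 'rV[R]_n) :
    Prop :=
  [/\ Omega !=set0, open Omega, connected Omega & bounded_set Omega].

Definition boundary (T : topologicalType) (A : set T) : set T :=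
  closure A `\` A°.

Definition partial (R : realType) (n : nat) (i : 'I_n) (phi : 'rV[R]_n -> R) :
    'rV[R]_n -> R :=
  fun x => 'D_(delta_mx ord0 i) phi x.

Definition gradient (R : realType) (n : nat) (phi : 'rV[R]_n -> R)
    (x : 'rV[R]_n) : 'rV[R]_n :=
  \row_(i < n) partial i phi x.

(* Functions on an open set Omega are represented by total functions whose
   values outside Omega are irrelevant; since Omega is open, two-sided
   derivatives and ambient continuity at points of Omega do not see them. *)
Definition C0 (R : realType) (n : nat) (Omega : set 'rV[R]_n)
    (phi : 'rV[R]_n -> R) : Prop :=
  forall x, Omega x -> {for x, continuous phi}.

Definition C1 (R : realType) (n : nat) (Omega : set 'rV[R]_n)
    (phi : 'rV[R]_n -> R) : Prop :=
  C0 Omega phi /\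
  forall i : 'I_n,
    (forall x, Omega x -> derivable phi x (delta_mx ord0 i)) /\
    C0 Omega (partial i phi).

Definition C2 (R : realType) (n : nat) (Omega : set 'rV[R]_n)
    (phi : 'rV[R]_n -> R) : Prop :=
  C1 Omega phi /\ forall i : 'I_n, C1 Omega (partial i phi).

Definition infinity_laplacian (R : realType) (n : nat) (phi : 'rV[R]_n -> R)
    (x : 'rV[R]_n) : R :=
  \sum_(i < n) \sum_(j < n)
    partial j (partial i phi) x * partial i phi x * partial j phi x.

(* Semicontinuity of the restriction of u to Omega: in [subspace Omega] the
   points outside Omega are isolated, so they impose no condition. *)
Definition lsc_on (R : realType) (n : nat) (Omega : set 'rV[R]_n)
    (u : 'rV[R]_n -> R) : Prop :=
  lower_semicontinuous (fun x : subspace Omega => (u x)%:E).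

Definition usc_on (R : realType) (n : nat) (Omega : set 'rV[R]_n)
    (u : 'rV[R]_n -> R) : Prop :=
  lsc_on Omega (fun x => - u x).

Definition strict_local_max (R : realType) (n : nat) (Omega : set 'rV[R]_n)
    (g : 'rV[R]_n -> R) (x : 'rV[R]_n) : Prop :=
  \forall y \near x, Omega y -> y <> x -> g y < g x.

Definition strict_local_min (R : realType) (n : nat) (Omega : set 'rV[R]_n)
    (g : 'rV[R]_n -> R) (x : 'rV[R]_n) : Prop :=
  \forall y \near x, Omega y -> y <> x -> g x < g y.

(* min{Delta_oo phi (x), |D phi (x)| - chi_E (x)}. *)
Definition min_operator (R : realType) (n : nat) (E : set 'rV[R]_n)
    (phi : 'rV[R]_n -> R) (x : 'rV[R]_n) : R :=
  Num.min (infinity_laplacian phi x) (enorm (gradient phi x) - \1_E x).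

Definition viscosity_subsolution (R : realType) (n : nat)
    (Omega D : set 'rV[R]_n) (u : 'rV[R]_n -> R) : Prop :=
  usc_on Omega u /\
  forall (x : 'rV[R]_n) (phi : 'rV[R]_n -> R),
    Omega x -> C2 Omega phi ->
    strict_local_max Omega (fun y => u y - phi y) x ->
    0 <= min_operator (interior D) phi x.

Definition viscosity_supersolution (R : realType) (n : nat)
    (Omega D : set 'rV[R]_n) (v : 'rV[R]_n -> R) : Prop :=
  lsc_on Omega v /\
  forall (x : 'rV[R]_n) (phi : 'rV[R]_n -> R),
    Omega x -> C2 Omega phi ->
    strict_local_min Omega (fun y => v y - phi y) x ->
    min_operator (closure D) phi x <= 0.

Definition viscosity_solution (R : realType) (n : nat)
    (Omega D : set 'rV[R]_n) (u : 'rV[R]_n -> R) : Prop :=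
  [/\ {within Omega, continuous u},
      viscosity_subsolution Omega D u &
      viscosity_supersolution Omega D u].

Definition boundary_condition (R : realType) (n : nat) (Omega : set 'rV[R]_n)
    (f u : 'rV[R]_n -> R) : Prop :=
  forall z, boundary Omega z -> u x @[x --> within Omega (nbhs z)] --> f z.

Definition solves_problem (R : realType) (n : nat) (Omega D : set 'rV[R]_n)
    (f u : 'rV[R]_n -> R) : Prop :=
  viscosity_solution Omega D u /\ boundary_condition Omega f u.

(* Main.v *)
(* Both halves rest on comparison with cones. A subsolution lies below the cones
   a + b|y - z|, b >= 0, that dominate it on the boundary, and a supersolution
   lies above the cones a - b|y - z| with b >= 1, or with b >= 0 off the closure
   of D. Hence, writing u^r(x) for the maximum of u over the closed ball of
   radius r, r |-> u^r(x) is convex for a subsolution u, and u^r(x) >= u(x) + r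
   for x in int D, thus by density for x in the closure of D.

   Uniqueness follows the Armstrong-Smart proof of Jensen's theorem: if u > v
   somewhere, maximize the sum of (1 + th) u^{N e} and (-v)^e. The difference
   inequalities at scale e, propagated along steps of length e, make the set of
   maximum points unbounded. The term (-v)^e feels the constraint within 2 e of
   the closure of D; since u is shifted by the much larger radius N e, convexity
   gives (1 + th) u^{N e} slope at least 1 there, so the discontinuity of chi_D
   does no harm.

   Existence is Perron's method; cones with vertex on the boundary are barriers
   on both sides, and comparison with cones makes the supremum Lipschitz. *)
Require Import Defs.
From mathcomp Require Import all_boot all_order all_algebra.
From mathcomp Require Import all_classical all_reals all_analysis.
From mathcomp Require Import ring lra.
Import Order.TTheory GRing.Theory Num.Theory.
Import numFieldNormedType.Exports.

Set Implicit Arguments.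
Unset Strict Implicit.
Unset Printing Implicit Defensive.

Local Open Scope classical_set_scope.
Local Open Scope ring_scope.

(** * Euclidean balls and compactness *)

Section Euclid.
Context {R : realType} {n : nat}.
Implicit Types (v w x y z : 'rV[R]_n) (r : R) (A : set 'rV[R]_n).

(** The minimum in the equation gives a supersolution [v] only a disjunction: near [closure D] the
    first increment of [-v] over a radius [e] may exceed the second, provided that it is at most
    [e]. A maximum point excludes this if the other term rises by at least [e] per step. A
    subsolution is known to rise at rate one only from points of [closure D], and passing to such a
    point costs about [2 * L * e], with [L] a Lipschitz constant. Over [N.+2] steps this loss is a
    fraction of order [1 / N] of the rise, and the factor [1 + th] pays for it. Hence [L] and [th]
    are fixed before [N], and [N] before [e]; this is possible because [L] comes from cones on balls
    of a fixed radius.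

    Values outside the domain are arbitrary, so boundary values enter the comparison only through
    compactness of the sets where [u - v] is at least a positive number, and cones are compared on
    compact subsets of the domain.

    Perron's class contains continuous functions only. The cone estimate for its members passes to
    the supremum and makes it continuous, so no semicontinuous envelope appears and a bumped
    supremum is again in the class. *)

Definition sqnorm v : R := \sum_(i < n) v ord0 i ^+ 2.

Definition dot v w : R := \sum_(i < n) v ord0 i * w ord0 i.

Lemma sqnorm_ge0 v : 0 <= sqnorm v.
Proof. by apply: sumr_ge0 => i _; exact: sqr_ge0. Qed.

Lemma enorm_ge0 v : 0 <= enorm v.
Proof. exact: sqrtr_ge0. Qed.

Lemma enorm_sq v : enorm v ^+ 2 = sqnorm v.
Proof. exact/sqr_sqrtr/sqnorm_ge0. Qed.

Lemma coord_le_enorm v i : `|v ord0 i| <= enorm v.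
Proof.
rewrite -ler_sqr ?nnegrE ?enorm_ge0//= enorm_sq -normrX ger0_norm ?sqr_ge0//.
by rewrite /sqnorm (bigD1 i)//= lerDl sumr_ge0// => j _; exact: sqr_ge0.
Qed.

Lemma enorm_eq0 v : enorm v = 0 -> v = 0.
Proof.
move=> v0; apply/rowP => i; rewrite mxE.
by apply/eqP; rewrite -normr_le0 -v0 coord_le_enorm.
Qed.

Lemma enorm_gt0 v : v != 0 -> 0 < enorm v.
Proof.
by move=> v0; rewrite lt_neqAle enorm_ge0 andbT eq_sym; apply: contra_neq v0; exact: enorm_eq0.
Qed.

Lemma enorm0 : enorm (0 : 'rV[R]_n) = 0.
Proof.
by rewrite /enorm big1 ?sqrtr0// => i _; rewrite mxE expr0n.
Qed.

Lemma enormN v : enorm (- v) = enorm v.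
Proof. by congr Num.sqrt; apply: eq_bigr => i _; rewrite mxE sqrrN. Qed.

Lemma enormB v w : enorm (v - w) = enorm (w - v).
Proof. by rewrite -enormN opprB. Qed.

Lemma enormZ (a : R) v : enorm (a *: v) = `|a| * enorm v.
Proof.
rewrite /enorm -sqrtr_sqr -sqrtrM ?sqr_ge0// mulr_sumr; congr Num.sqrt.
by apply: eq_bigr => i _; rewrite mxE exprMn.
Qed.

Lemma dot_le v w : dot v w <= enorm v * enorm w.
Proof.
have [->|v0] := eqVneq v 0.
  by rewrite enorm0 mul0r /dot big1// => i _; rewrite mxE mul0r.
have [->|w0] := eqVneq w 0.
  by rewrite enorm0 mulr0 /dot big1// => i _; rewrite mxE mulr0.
have vp := enorm_gt0 v0; have wp := enorm_gt0 w0.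
set a := enorm v in vp *; set b := enorm w in wp *.
(* AM-GM termwise: [2 v_i w_i <= (b/a) v_i^2 + (a/b) w_i^2]. *)
have -> : a * b = \sum_(i < n) ((b / a * v ord0 i ^+ 2 + a / b * w ord0 i ^+ 2) / 2).
  rewrite -mulr_suml big_split/= -!mulr_sumr -!/(sqnorm _) -!enorm_sq -/a -/b.
  by field; rewrite !gt_eqF.
apply: ler_sum => i _; rewrite -subr_ge0.
have -> : (b / a * v ord0 i ^+ 2 + a / b * w ord0 i ^+ 2) / 2 - v ord0 i * w ord0 i
   = (b * v ord0 i - a * w ord0 i) ^+ 2 / (2 * (a * b)).
  by field; rewrite !gt_eqF.
by rewrite divr_ge0 ?sqr_ge0// !mulr_ge0// ltW.
Qed.

Lemma sqnormD v w : sqnorm (v + w) = sqnorm v + 2 * dot v w + sqnorm w.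
Proof.
rewrite /sqnorm /dot mulr_sumr -!big_split/=; apply: eq_bigr => i _.
by rewrite mxE; ring.
Qed.

Lemma enormD v w : enorm (v + w) <= enorm v + enorm w.
Proof.
rewrite -ler_sqr ?nnegrE ?addr_ge0 ?enorm_ge0//= enorm_sq sqnormD -!enorm_sq.
by have := dot_le v w; lra.
Qed.

Lemma enorm_tri y x z : enorm (x - z) <= enorm (x - y) + enorm (y - z).
Proof. by have := enormD (x - y) (y - z); rewrite addrA subrK. Qed.

Lemma enorm_dist x y : `|enorm x - enorm y| <= enorm (x - y).
Proof.
rewrite ler_norml; apply/andP; split.
  have := enormD (y - x) x; rewrite subrK enormB; lra.
have := enormD (x - y) y; rewrite subrK; lra.
Qed.

Lemma norm_le_enorm v : `|v| <= enorm v.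
Proof.
rewrite [leLHS]/Num.norm/= mx_normrE; apply/bigmax_leP; split; first exact: enorm_ge0.
by move=> [i j] _ /=; rewrite (ord1 i) coord_le_enorm.
Qed.

Lemma coord_le_norm v i : `|v ord0 i| <= `|v|.
Proof.
by rewrite [leRHS]/Num.norm/= mx_normrE; apply/bigmax_geP; right; exists (ord0, i).
Qed.

Lemma enorm_le_norm v : enorm v <= n%:R * `|v|.
Proof.
rewrite -ler_sqr ?nnegrE ?enorm_ge0 ?mulr_ge0//= enorm_sq.
apply: (@le_trans _ _ (n%:R * `|v| ^+ 2)).
  have -> : n%:R * `|v| ^+ 2 = \sum_(i < n) `|v| ^+ 2.
    by rewrite sumr_const card_ord mulr_natl.
  apply: ler_sum => i _.
  by rewrite -real_normK ?num_real// ler_sqr ?nnegrE// coord_le_norm.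
rewrite exprMn ler_wpM2r ?sqr_ge0// -natrX ler_nat.
by case: (n) => // k; rewrite expnS leq_pmulr// expn_gt0.
Qed.

(** Euclidean, because cones are built on [enorm] while the library balls are cubes; closed, hence
    compact, so that maxima over balls are attained. *)
Definition cB x r : set 'rV[R]_n := [set y | enorm (y - x) <= r].

Lemma cBxx x r : 0 <= r -> cB x r x.
Proof. by rewrite /cB/= subrr enorm0. Qed.

Lemma cB_sym x y r : cB x r y -> cB y r x.
Proof. by rewrite /cB/= enormB. Qed.

Lemma cB_trans y x z r s : cB x r y -> cB y s z -> cB x (r + s) z.
Proof. by rewrite /cB/= => xy yz; have := enorm_tri y z x; lra. Qed.

Lemma cB_le x r s : r <= s -> cB x r `<=` cB x s.
Proof. by move=> rs y /= /le_trans; exact. Qed.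

Lemma nbhs_cBP x A : nbhs x A <-> exists2 r, 0 < r & cB x r `<=` A.
Proof.
split.
  move=> /(iffLR (@nbhs_normP R _ x A))[e /= e0 eA]; exists (e / 2); first by rewrite divr_gt0.
  move=> y; rewrite /cB/= => yx; apply: eA => /=.
  rewrite -normrN opprB; apply: le_lt_trans (norm_le_enorm _) _; lra.
(* Dividing by [n.+1] instead of [n] keeps the radius positive in dimension zero. *)
move=> [r r0 rA]; apply: (iffRL (@nbhs_normP R _ x A)); exists (r / n.+1%:R) => /=.
  by rewrite divr_gt0.
move=> y /= xy; apply: rA; rewrite /cB/=.
apply: (le_trans (enorm_le_norm _)).
move: xy; rewrite -normrN opprB ltr_pdivlMr// => /ltW; apply: le_trans.
by rewrite mulrC ler_wpM2l// ler_nat.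
Qed.

Lemma nbhs_cB x r : 0 < r -> nbhs x (cB x r).
Proof. by move=> r0; apply/nbhs_cBP; exists r. Qed.

Lemma open_cBP A : open A -> forall x, A x -> exists2 r, 0 < r & cB x r `<=` A.
Proof. by move=> oA x Ax; apply/nbhs_cBP; exact: open_nbhs_nbhs. Qed.

Lemma continuous_cBP (u : 'rV[R]_n -> R) x : {for x, continuous u} <->
  forall e, 0 < e -> exists2 d, 0 < d & forall y, cB x d y -> `|u y - u x| <= e.
Proof.
split=> [cu e e0|cu].
  have /cvgrPdist_le/(_ e e0)/nbhs_cBP[d d0 dP] := cu.
  by exists d => // y /dP /=; rewrite distrC.
apply: (iffRL (@cvgrPdist_le _ _ _ (nbhs x) _ u (u x))) => e e0; have [d d0 dP] := cu e e0.
by apply/nbhs_cBP; exists d => // y /dP; rewrite distrC.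
Qed.

Lemma closed_cBP A :
  (forall x, (forall r, 0 < r -> exists2 y, A y & cB x r y) -> A x) -> closed A.
Proof.
move=> H x cAx; apply: H => r r0.
by have [y [Ay xy]] := cAx _ (nbhs_cB x r0); exists y.
Qed.

Lemma closure_cBP A x : closure A x <->
  forall r, 0 < r -> exists2 y, A y & cB x r y.
Proof.
split=> [cA r r0|H].
  by have [y [Ay xy]] := cA _ (nbhs_cB x r0); exists y.
by move=> B /nbhs_cBP[r r0 rB]; have [y Ay /rB By] := H r r0; exists y.
Qed.

Lemma enormB_continuous z : continuous (fun x => enorm (x - z)).
Proof.
move=> x; apply/continuous_cBP => e e0; exists e => // y xy.
by apply: le_trans (enorm_dist _ _) _; rewrite opprB addrA subrK.
Qed.

Lemma sqnormB_continuous z : continuous (fun x => sqnorm (x - z)).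
Proof.
have -> : (fun x => sqnorm (x - z)) = (fun x => enorm (x - z) * enorm (x - z)).
  by apply/funext => x; rewrite -enorm_sq expr2.
by move=> x; apply: (@continuousM _ _ (fun x => enorm (x - z)) (fun x => enorm (x - z))); exact: enormB_continuous.
Qed.

Lemma compact_cBP A z r : closed A -> A `<=` cB z r -> compact A.
Proof.
move=> cA Ar; apply: bounded_closed_compact => //.
exists (r + enorm z); split; first exact: num_real.
move=> M rM x /Ar; rewrite /cB/= => xz; apply: le_trans (norm_le_enorm x) _.
have := enormD (x - z) z; rewrite subrK; lra.
Qed.

Lemma compact_cB x r : compact (cB x r).
Proof.
apply: (@compact_cBP _ x r) => //; apply: closed_cBP => y H.
rewrite /cB/= leNgt; apply/negP => ry.
have [|z] := H ((enorm (y - x) - r) / 2); first by lra.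
by rewrite /cB/= => zx zy; have := enorm_tri z y x; rewrite (enormB y z); lra.
Qed.

Lemma cB_continuous_within A (u : 'rV[R]_n -> R) :
  (forall x, A x -> {for x, continuous u}) -> {within A, continuous u}.
Proof.
by move=> cu; apply: continuous_in_subspaceT => x /set_mem; exact: cu.
Qed.

Lemma compact_argmax A (u : 'rV[R]_n -> R) : compact A -> A !=set0 ->
  (forall x, A x -> {for x, continuous u}) ->
  exists2 x, A x & forall y, A y -> u y <= u x.
Proof.
move=> cA A0 /cB_continuous_within cu.
have [x /set_mem Ax H] := compact_EVT_max A0 cA cu.
by exists x => // y Ay; apply: H; exact/mem_set.
Qed.

Lemma compact_lt_gap A (u : 'rV[R]_n -> R) (a : R) : compact A ->
  (forall x, A x -> {for x, continuous u}) -> (forall x, A x -> u x < a) ->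
  exists2 e, 0 < e & forall x, A x -> u x + e <= a.
Proof.
move=> cA cu ua; have [->|/set0P A0] := eqVneq A set0; first by exists 1.
have [x Ax H] := compact_argmax cA A0 cu.
exists (a - u x); first by rewrite subr_gt0 ua.
by move=> y /H; lra.
Qed.

Lemma compact_bound A (u : 'rV[R]_n -> R) : compact A ->
  (forall x, A x -> {for x, continuous u}) ->
  exists2 M, 0 < M & forall x, A x -> `|u x| <= M.
Proof.
move=> cA cu.
have [->|/set0P A0] := eqVneq A set0; first by exists 1.
have [|x Ax H] := @compact_argmax A (fun x => `|u x|) cA A0.
  move=> x /cu/continuous_cBP cux; apply/continuous_cBP => e /cux[d d0 dP].
  by exists d => // y /dP; apply: le_trans (ler_dist_dist _ _).
exists (`|u x| + 1); first by rewrite ltr_wpDl.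
by move=> y /H yx; apply: le_trans yx _; rewrite lerDl.
Qed.

Lemma compact_dist A B : compact A -> open B -> A `<=` B ->
  exists2 r, 0 < r & forall x, A x -> cB x r `<=` B.
Proof.
move=> cA oB AB.
have [->|/set0P A0] := eqVneq A set0; first by exists 1.
(* Largest admissible radius, capped at [1], is 1-Lipschitz and positive. *)
pose S x := [set r : R | 0 <= r <= 1 /\ cB x r `<=` B \/ r = 0].
pose d x := sup (S x).
have S0 x : S x 0 by right.
have Sub x r : S x r -> 0 <= r <= 1 by move=> [[]|->] //; rewrite lexx ler01.
have Ssup x : has_sup (S x).
  by split; [exists 0 | exists 1 => r /Sub /andP[]].
have d0 x : 0 <= d x by apply: sup_upper_bound.
have dlip x y : d x - enorm (x - y) <= d y.
  rewrite lerBlDr; apply: ge_sup => [|r Sr]; first by exists 0.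
  have [rle|rgt] := lerP r (enorm (x - y)).
    by apply: le_trans rle _; rewrite lerDr.
  rewrite -lerBlDr; apply: sup_upper_bound => //; left.
  have /andP[r0 r1] := Sub _ _ Sr; have e0 := enorm_ge0 (x - y).
  split; first by lra.
  move: Sr => [[_ rB]|]; last by lra.
  move=> z zy; apply: rB; rewrite /cB/= in zy *.
  by have := enorm_tri y z x; rewrite (enormB y x); lra.
have dcont : forall x, A x -> {for x, continuous d}.
  move=> x _; apply/continuous_cBP => e e0; exists e => // y xy.
  move: xy; rewrite /cB/= => xy; rewrite ler_norml; have := dlip x y; have := dlip y x.
  by rewrite (enormB x y); lra.
have [|x Ax H] := @compact_argmax A (fun x => - d x) cA A0.
  by move=> x /dcont dx; exact: continuousN.
have dx0 : 0 < d x.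
  have [r r0 rB] := open_cBP oB (AB _ Ax).
  apply: (@lt_le_trans _ _ (Num.min r 1)); first by rewrite lt_min r0 ltr01.
  apply: sup_upper_bound => //; left; split.
    by rewrite le_min (ltW r0) ler01 ge_min lexx orbT.
  by move=> y yx; apply: rB; apply: le_trans yx _; rewrite ge_min lexx.
exists (d x / 2); first by lra.
move=> y Ay; have := H _ Ay; rewrite lerN2 => dxy.
have hd : 0 < d x / 2 by lra.
have [r [[_ rB]|->] dr] := sup_adherent hd (Ssup y); rewrite -/(d y) in dr.
- by move=> z zy; apply: rB; apply: le_trans zy _; lra.
- by lra.
Qed.

(** The intermediate point is taken on the segment from [x] to [y]; this is what makes maxima over
    balls a semigroup in the radius. *)
Lemma cB_split x y (s t : R) : 0 <= s -> 0 <= t -> cB x (s + t) y ->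
  exists2 z, cB x s z & cB z t y.
Proof.
rewrite /cB/= => s0 t0 yx.
have [ys|ys] := lerP (enorm (y - x)) s.
  by exists y => //; rewrite subrr enorm0.
have d0 : 0 < enorm (y - x) by apply: le_lt_trans ys.
exists (x + (s / enorm (y - x)) *: (y - x)).
  rewrite addrAC subrr add0r enormZ ger0_norm ?divr_ge0 ?(ltW d0)//.
  by rewrite divfK// gt_eqF.
have -> : y - (x + s / enorm (y - x) *: (y - x)) = (1 - s / enorm (y - x)) *: (y - x).
  by rewrite scalerBl scale1r opprD addrA.
rewrite enormZ ger0_norm; last by rewrite subr_ge0 ler_pdivrMr// mul1r ltW.
by rewrite mulrBl mul1r divfK ?gt_eqF//; lra.
Qed.

End Euclid.

(** * Differential calculus *)

Section DirectionalDerivatives.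
Context {R : realType} {n : nat}.

(** Multiplied by [h], the estimate of the difference quotient also holds at [h = 0], so that later
    arguments avoid punctured neighbourhoods. *)
Lemma is_derive_epsP (V : normedModType R) (f : V -> R) (a v : V) (l : R) :
  is_derive a v f l <->
  forall e, 0 < e -> exists2 d, 0 < d &
    forall h, `|h| <= d -> `|f (a + h *: v) - f a - l * h| <= e * `|h|.
Proof.
pose q (h : R) := h^-1 *: (f (h *: v + a) - f a).
have quot h e : h != 0 ->
    (`|l - q h| <= e) = (`|f (a + h *: v) - f a - l * h| <= e * `|h|).
  move=> h0; rewrite -ler_pdivrMr ?normr_gt0// -normfV -normrM -[in LHS]normrN.
  by congr (`|_| <= _); rewrite /q (addrC a) /GRing.scale/=; field.
split=> [[cf lE] e e0|H].
  have {}lE : lim (q h @[h --> 0^']) = l by rewrite -lE.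
  have /cvgrPdist_le/(_ e e0) : q h @[h --> 0^'] --> l by rewrite -lE.
  rewrite near_withinE => /nbhs_normP[d /= d0 dP].
  exists (d / 2); first by rewrite divr_gt0.
  move=> h hd; have [->|h0] := eqVneq h 0.
    by rewrite scale0r addr0 mulr0 !subrr normr0 mulr0.
  rewrite -quot//; apply: dP => //=; rewrite sub0r normrN.
  by apply: le_lt_trans hd _; lra.
have cq : q h @[h --> 0^'] --> l.
  apply/cvgrPdist_le => e e0; have [d d0 dP] := H e e0.
  rewrite near_withinE; apply/nbhs_normP; exists d => // h /=.
  by rewrite sub0r normrN => /ltW/dP hd h0; rewrite quot.
split; first by apply/cvg_ex; exists l.
exact: cvg_lim cq.
Qed.

Lemma is_derive_line (V : normedModType R) (f : V -> R) (a v : V) (t l : R) :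
  is_derive (a + t *: v) v f l -> is_derive t 1 (fun s : R => f (a + s *: v)) l.
Proof.
move=> /is_derive_epsP H; apply/is_derive_epsP => e /H[d d0 dP].
exists d => // h /dP.
suff -> : a + t *: v + h *: v = a + (t + h *: 1) *: v by [].
by rewrite -addrA -scalerDl [h *: 1]mulr1.
Qed.

Lemma is_derive1_chain (f h : R -> R) (x df dh : R) :
  is_derive x 1 f df -> is_derive (f x) 1 h dh ->
  is_derive x 1 (fun s => h (f s)) (dh * df).
Proof.
move=> [f1 f2] [h1 h2].
have df' := iffLR (derivable1_diffP f x) f1.
have dh' := iffLR (derivable1_diffP h (f x)) h1.
split; first exact: (iffRL (derivable1_diffP (h \o f) x) (differentiable_comp df' dh')).
by have := derive1_comp f1 h1; rewrite !derive1E f2 h2.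
Qed.

(** Restricting [f] to the line through [a] in direction [v] reduces this to the chain rule in one
    variable; [f] is only assumed derivable in that direction. *)
Lemma is_derive_chain (V : normedModType R) (f : V -> R) (h : R -> R) (a v : V)
    (df dh : R) :
  is_derive a v f df -> is_derive (f a) 1 h dh ->
  is_derive a v (fun y => h (f y)) (dh * df).
Proof.
move=> fa ha.
have La : is_derive (0 : R) 1 (fun s : R => f (a + s *: v)) df.
  by apply: is_derive_line; rewrite scale0r addr0.
have /is_derive_epsP H : is_derive (0 : R) 1 (fun s : R => h (f (a + s *: v))) (dh * df).
  by apply: is_derive1_chain => //; rewrite scale0r addr0.
apply/is_derive_epsP => e /H[d d0 dP]; exists d => // t /dP.
by rewrite scale0r addr0 add0r [t *: 1]mulr1.
Qed.

Lemma MVT_line (G dG : R -> R) (t : R) : 0 < t ->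
  (forall s, 0 <= s <= t -> is_derive s 1 G (dG s)) ->
  exists2 c, 0 < c < t & G t - G 0 = dG c * t.
Proof.
move=> t0 dGP.
have [||c] := @MVT R G dG 0 t t0.
- move=> s; rewrite in_itv/= => /andP[s0 st]; apply: dGP; lra.
- apply: derivable_within_continuous => s; rewrite in_itv/= => st.
  by have [] := dGP s st.
- by rewrite in_itv/= subr0; exists c.
Qed.

Implicit Types (x y z p : 'rV[R]_n) (O : set 'rV[R]_n) (phi psi : 'rV[R]_n -> R).

Local Notation e_ i := (delta_mx ord0 i : 'rV[R]_n).

Lemma C0_eq O phi psi : open O -> (forall y, O y -> phi y = psi y) ->
  C0 O psi -> C0 O phi.
Proof.
move=> oO E cpsi x Ox; apply/continuous_cBP => e e0.
have /continuous_cBP/(_ e e0)[d d0 dP] := cpsi _ Ox.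
have [r r0 rO] := open_cBP oO Ox.
exists (Num.min d r); first by rewrite lt_min d0.
move=> y yx; rewrite !E//; last first.
  by apply/rO/(le_trans yx); rewrite ge_min lexx orbT.
by apply/dP/(le_trans yx); rewrite ge_min lexx.
Qed.

Lemma is_derive_open_eq O phi psi x v l : open O -> O x ->
  (forall y, O y -> phi y = psi y) -> is_derive x v phi l -> is_derive x v psi l.
Proof.
move=> oO Ox E; apply: near_eq_is_derive.
by apply: filterS (open_nbhs_nbhs (conj oO Ox)) => y /E.
Qed.

(** The partial derivatives are known only on [O]. As [O] is open and derivatives are local,
    [partial i phi] may be replaced by the candidate [g i] before differentiating again. *)
Lemma C2_intro O phi (g : 'I_n -> 'rV[R]_n -> R) (H : 'I_n -> 'I_n -> 'rV[R]_n -> R) :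
  open O -> C0 O phi -> (forall i, C0 O (g i)) -> (forall i j, C0 O (H i j)) ->
  (forall i y, O y -> is_derive y (e_ i) phi (g i y)) ->
  (forall i j y, O y -> is_derive y (e_ j) (g i) (H i j y)) ->
  [/\ C2 O phi, forall i y, O y -> partial i phi y = g i y &
      forall i j y, O y -> partial j (partial i phi) y = H i j y].
Proof.
move=> oO cphi cg cH dphi dg.
have pE i y : O y -> partial i phi y = g i y.
  by move=> /(dphi i)[].
have dp i j y : O y -> is_derive y (e_ j) (partial i phi) (H i j y).
  by move=> Oy; apply: (is_derive_open_eq oO Oy) (dg i j y Oy) => z /(pE i)->.
have ppE i j y : O y -> partial j (partial i phi) y = H i j y.
  by move=> /(dp i j)[].
split=> //; split.
  split=> // i; split; first by move=> x /(dphi i)[].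
  exact: (C0_eq oO (pE i)).
move=> i; split; first exact: (C0_eq oO (pE i)).
move=> j; split; first by move=> x /(dp i j)[].
exact: (C0_eq oO (ppE i j)).
Qed.

Lemma C2_is_derive O phi i y : C2 O phi -> O y ->
  is_derive y (e_ i) phi (partial i phi y).
Proof. by move=> [[_ /(_ i)[H _]] _] /H; exact: derivableP. Qed.

Lemma C2_is_derive2 O phi i j y : C2 O phi -> O y ->
  is_derive y (e_ j) (partial i phi) (partial j (partial i phi) y).
Proof. by move=> [_ /(_ i)[_ /(_ j)[H _]]] /H; exact: derivableP. Qed.

Lemma C2_C0 O phi : C2 O phi -> C0 O phi.
Proof. by move=> [[]]. Qed.

Lemma C2_C0_partial O phi i : C2 O phi -> C0 O (partial i phi).
Proof. by move=> [_ /(_ i)[]]. Qed.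

Lemma C2_C0_partial2 O phi i j : C2 O phi -> C0 O (partial j (partial i phi)).
Proof. by move=> [_ /(_ i)[_ /(_ j)[]]]. Qed.

Lemma C0_comb O phi psi (a b : R) : C0 O phi -> C0 O psi ->
  C0 O (fun y => a * phi y + b * psi y).
Proof.
move=> c1 c2 x Ox; apply: continuousD; apply: continuousM; try exact: cst_continuous.
  exact: c1.
exact: c2.
Qed.

Lemma is_derive_comb (V : normedModType R) (f g : V -> R) (c v : V) (a b df dg : R) :
  is_derive c v f df -> is_derive c v g dg ->
  is_derive c v (fun u => a * f u + b * g u) (a * df + b * dg).
Proof. by move=> *; apply: is_deriveD. Qed.

Lemma C2_comb O phi psi (a b : R) : open O -> C2 O phi -> C2 O psi ->
  [/\ C2 O (fun y => a * phi y + b * psi y),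
      forall i y, O y -> partial i (fun y => a * phi y + b * psi y) y =
        a * partial i phi y + b * partial i psi y &
      forall i j y, O y -> partial j (partial i (fun y => a * phi y + b * psi y)) y =
        a * partial j (partial i phi) y + b * partial j (partial i psi) y].
Proof.
move=> oO c1 c2; apply: C2_intro => //.
- by apply: C0_comb; exact: C2_C0.
- by move=> i; apply: C0_comb; exact: C2_C0_partial.
- by move=> i j; apply: C0_comb; exact: C2_C0_partial2.
- by move=> i y Oy; exact: is_derive_comb (C2_is_derive i c1 Oy) (C2_is_derive i c2 Oy).
- by move=> i j y Oy; exact: is_derive_comb (C2_is_derive2 i j c1 Oy) (C2_is_derive2 i j c2 Oy).
Qed.

(** [C1] speaks of partial derivatives only; their continuity yields differentiability. The error is
    an l1 norm because it is collected one coordinate at a time. *)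
Lemma C1_approx O phi y (e : R) : open O -> C1 O phi -> O y -> 0 < e ->
  exists2 d, 0 < d & cB y d `<=` O /\ forall w, enorm w <= d ->
    `|phi (y + w) - phi y - \sum_(i < n) w ord0 i * partial i phi y|
      <= e * \sum_(i < n) `|w ord0 i|.
Proof.
move=> oO [_ pphi] Oy e0.
have [r r0 rO] := open_cBP oO Oy.
have ex_d i : exists2 d, 0 < d & forall z, cB y d z ->
    `|partial i phi z - partial i phi y| <= e.
  by have [_ /(_ y Oy)/continuous_cBP/(_ e e0)] := pphi i.
have [d d0 dP] : exists2 d, 0 < d & forall i z, cB y d z ->
    `|partial i phi z - partial i phi y| <= e.
  have /choice[D DP] : forall i, exists d, 0 < d /\ forall z, cB y d z ->
      `|partial i phi z - partial i phi y| <= e.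
    by move=> i; have [d ? ?] := ex_d i; exists d.
  exists (\big[Num.min/1]_i D i).
    by apply: lt_bigmin => // i _; have [] := DP i.
  move=> i z yz; have [_] := DP i; apply; apply: le_trans yz _.
  exact: bigmin_le_cond.
exists (Num.min d r); first by rewrite lt_min d0.
have Dd z : cB y (Num.min d r) z -> cB y d z /\ O z.
  rewrite /cB/= le_min => /andP[yd yr]; split=> //; exact: rO.
split; first by move=> z /Dd[].
move=> w wd.
(* Change one coordinate at a time, applying the mean value theorem. *)
pose W k : 'rV[R]_n := \row_(i < n) (if (i < k)%N then w ord0 i else 0).
have step (k : 'I_n) :
    `|phi (y + W k.+1) - phi (y + W k) - w ord0 k * partial k phi y| <= e * `|w ord0 k|.
  pose P s := y + W k + (s * w ord0 k) *: e_ k.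
  have PO (s : R) : 0 <= s <= 1 -> cB y (Num.min d r) (P s).
    move=> s01; apply: le_trans wd.
    have -> : P s - y = W k + (s * w ord0 k) *: e_ k by rewrite /P addrAC [X in X + _]addrAC subrr add0r.
    rewrite -ler_sqr ?nnegrE ?enorm_ge0//= !enorm_sq.
    apply: ler_sum => i _; rewrite !mxE /= -[leLHS]real_normK ?num_real//.
    rewrite -[leRHS]real_normK ?num_real// ler_sqr ?nnegrE//=.
    have [->|ik] := eqVneq i k.
      rewrite ltnn mulr1 add0r normrM ger0_norm; last by case/andP: s01.
      by rewrite ler_piMl//; case/andP: s01.
    by rewrite mulr0 addr0; case: ifP => // _; rewrite normr0.
  have dP' (s : R) : 0 <= s <= 1 -> is_derive s 1 (fun u : R => phi (P u))
      (partial k phi (P s) * w ord0 k).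
    move=> s01; have [_ Os] := Dd _ (PO _ s01).
    have L : is_derive (s * w ord0 k) 1 (fun t : R => phi (y + W k + t *: e_ k)) (partial k phi (P s)).
      apply: is_derive_line; have [/(_ _ Os) + _] := pphi k; exact: derivableP.
    apply: (is_derive1_chain (f := fun s => s * w ord0 k)) L.
    apply/is_derive_epsP => e' e'0; exists 1 => // h _.
    have -> : (s + h *: 1) * w ord0 k - s * w ord0 k - w ord0 k * h = 0.
      by rewrite [h *: 1]mulr1; ring.
    by rewrite normr0 mulr_ge0// ltW.
  have [c c01] := MVT_line ltr01 dP'.
  have -> : P 1 = y + W k.+1.
    rewrite /P mul1r -addrA; congr (_ + _); apply/rowP => i; rewrite !mxE/= ltnS.
    have [->|ik] := eqVneq i k; first by rewrite ltnn leqnn add0r mulr1.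
    by rewrite mulr0 addr0 [RHS]/= [in RHS]leq_eqVlt; have /negPf-> : nat_of_ord i != k := ik.
  have -> : P 0 = y + W k by rewrite /P mul0r scale0r addr0.
  move=> ->; rewrite mulr1 [w _ _ * _]mulrC -mulrBl normrM ler_wpM2r//.
  have c01' : 0 <= c <= 1 by lra.
  by have [cd _] := Dd _ (PO _ c01'); exact: dP.
have W0 : W 0%N = 0 by apply/rowP => i; rewrite !mxE.
have Wn : W n = w by apply/rowP => i; rewrite !mxE ltn_ord.
have -> : phi (y + w) - phi y = \sum_(k < n) (phi (y + W k.+1) - phi (y + W k)).
  rewrite -(big_mkord xpredT (fun k => phi (y + W k.+1) - phi (y + W k))).
  by rewrite (telescope_sumr (fun k => phi (y + W k)))// Wn W0 addr0.
rewrite -sumrB mulr_sumr; apply: le_trans (ler_norm_sum _ _ _) _.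
exact: ler_sum.
Qed.

Lemma C1_is_derive O phi y p : open O -> C1 O phi -> O y ->
  is_derive y p phi (\sum_(i < n) p ord0 i * partial i phi y).
Proof.
move=> oO c1 Oy; apply/is_derive_epsP => e e0.
pose P := \sum_(i < n) `|p ord0 i|.
have P0 : 0 <= P by apply: sumr_ge0.
have e'0 : 0 < e / (P + 1) by rewrite divr_gt0// ltr_wpDl.
have [d d0 [_ dP]] := C1_approx oO c1 Oy e'0.
have pe0 := enorm_ge0 p.
exists (d / (enorm p + 1)); first by rewrite divr_gt0// ltr_wpDl.
move=> h hd; have {}hd : enorm (h *: p) <= d.
  rewrite enormZ; apply: (@le_trans _ _ (`|h| * (enorm p + 1))).
    by rewrite ler_wpM2l// lerDl.
  by rewrite -ler_pdivlMr// ltr_wpDl.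
have := dP _ hd.
have -> : \sum_(i < n) (h *: p) ord0 i * partial i phi y =
    (\sum_(i < n) p ord0 i * partial i phi y) * h.
  by rewrite mulr_suml; apply: eq_bigr => i _; rewrite mxE; ring.
move=> /le_trans; apply.
have -> : \sum_(i < n) `|(h *: p) ord0 i| = `|h| * P.
  by rewrite mulr_sumr; apply: eq_bigr => i _; rewrite mxE normrM.
rewrite mulrCA [_ * `|h|]mulrC ler_wpM2l// -mulrA ler_piMr ?(ltW e0)//.
by rewrite mulrC ler_pdivrMr ?ltr_wpDl// mul1r lerDl.
Qed.

Lemma local_max_derive1_eq0 (G : R -> R) (l : R) :
  (exists2 d, 0 < d & forall t, `|t| <= d -> G t <= G 0) ->
  is_derive (0 : R) 1 G l -> l = 0.
Proof.
move=> [d0 d00 Gmax] /is_derive_epsP H; apply/eqP; apply: contraT => l0.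
have l2 : 0 < `|l| / 2 by rewrite divr_gt0// normr_gt0.
have [d d0' dP] := H _ l2.
pose m := Num.min d d0; have m0 : 0 < m by rewrite lt_min d0'.
(* A step in the ascending direction: it would raise [G] by at least half of [|l| * m]. *)
pose t := Num.sg l * m.
have tm : `|t| = m by rewrite normrM normr_sg l0 mul1r gtr0_norm.
have := dP t; rewrite tm ge_min lexx => /(_ isT).
rewrite add0r [t *: 1]mulr1.
have lt : l * t = `|l| * m by rewrite mulrA [l * _]mulrC -normrEsg.
rewrite lt ler_norml => /andP[+ _].
have := Gmax t; rewrite tm ge_min lexx orbT => /(_ isT).
have : 0 < `|l| * m by rewrite mulr_gt0// normr_gt0.
lra.
Qed.

(** If the quadratic form were positive at [p], the derivative along [p], which vanishes at [y],
    would be positive for small positive parameters, and the mean value theorem would push [g] above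
    its maximum. *)
Lemma local_max_second_order O g y : open O -> C2 O g -> O y ->
  (\forall x \near y, g x <= g y) ->
  (forall i, partial i g y = 0) /\
  forall p, \sum_(i < n) \sum_(j < n)
    partial j (partial i g) y * p ord0 i * p ord0 j <= 0.
Proof.
move=> oO c2 Oy /nbhs_cBP[r r0 rmax].
have max_line p : exists2 d, 0 < d & forall t : R, `|t| <= d ->
    g (y + t *: p) <= g (y + 0 *: p) /\ cB y r (y + t *: p).
  have pe0 := enorm_ge0 p.
  exists (r / (enorm p + 1)); first by rewrite divr_gt0// ltr_wpDl.
  move=> t; rewrite ler_pdivlMr ?ltr_wpDl// => tr.
  have ht : cB y r (y + t *: p).
    rewrite /cB/= addrAC subrr add0r enormZ; apply: le_trans tr.
    by rewrite ler_wpM2l// lerDl.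
  by split=> //; rewrite scale0r addr0; exact: rmax.
have g0 i : partial i g y = 0.
  apply: (@local_max_derive1_eq0 (fun t => g (y + t *: e_ i))).
    by have [d d0 dP] := max_line (e_ i); exists d => // t /dP[].
  by apply: is_derive_line; rewrite scale0r addr0; exact: (C2_is_derive _ c2).
split=> // p; rewrite leNgt; apply/negP => S0.
set S := \sum_(i < n) _ in S0.
pose dG t := \sum_(i < n) p ord0 i * partial i g (y + t *: p).
have ddG : is_derive y p (fun x => \sum_(i < n) p ord0 i * partial i g x) S.
  have -> : S = \sum_(i < n) p ord0 i * \sum_(j < n) p ord0 j * partial j (partial i g) y.
    apply: eq_bigr => i _; rewrite mulr_sumr; apply: eq_bigr => j _; ring.
  have -> : (fun x => \sum_(i < n) p ord0 i * partial i g x) =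
      \sum_(i < n) (fun x => p ord0 i * partial i g x).
    by apply/funext => x; rewrite fct_sumE.
  apply: is_derive_sum => i.
  have L : is_derive y p (partial i g) (\sum_(j < n) p ord0 j * partial j (partial i g) y).
    exact: (C1_is_derive p oO (c2.2 i) Oy).
  exact: is_deriveZ.
have S2 : 0 < S / 2 by rewrite divr_gt0.
have /is_derive_epsP/(_ _ S2)[d d0 dP] := ddG.
have [d1 d10 d1P] := max_line p.
have [d2 d20 d2P] := open_cBP oO Oy.
have pe0 := enorm_ge0 p.
pose t := Num.min (Num.min d d1) (d2 / (enorm p + 1)).
have t0 : 0 < t by rewrite !lt_min d0 d10 divr_gt0// ltr_wpDl.
have [s s0|c /andP[c0 ct]] := MVT_line (G := fun t => g (y + t *: p)) (dG := dG) t0.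
  apply: is_derive_line; apply: (C1_is_derive _ oO); first by case: c2.
  apply: d2P; rewrite /cB/= addrAC subrr add0r enormZ.
  have : `|s| <= t by rewrite ger0_norm; case/andP: s0.
  rewrite !le_min => /andP[_]; rewrite ler_pdivlMr ?ltr_wpDl//; apply: le_trans.
  by rewrite ler_wpM2l// lerDl.
have [] := d1P t; first by rewrite gtr0_norm// !ge_min lexx orbT.
move=> gt _ E; have : dG c * t <= 0 by rewrite -E; lra.
rewrite pmulr_lle0// => dGc.
have := dP c; rewrite (gtr0_norm c0).
have -> : c <= d by apply: (le_trans (ltW ct)); rewrite !ge_min lexx.
have -> : \sum_(i < n) p ord0 i * partial i g y = 0.
  by rewrite big1// => i _; rewrite g0 mulr0.
rewrite -/(dG c) subr0 => /(_ isT); rewrite ler_norml => /andP[+ _].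
have : 0 < S * c by rewrite mulr_gt0.
by lra.
Qed.

Lemma gradientE phi x i : gradient phi x ord0 i = partial i phi x.
Proof. by rewrite mxE. Qed.

(** It turns classical inequalities for [phi] into viscosity ones. The second-order condition for
    [phi - psi] is read in the direction of the common gradient, the only one that the infinity
    Laplacian sees. *)
Lemma local_max_classical O phi psi y : open O -> C2 O phi -> C2 O psi -> O y ->
  (\forall x \near y, phi x - psi x <= phi y - psi y) ->
  gradient phi y = gradient psi y /\
  infinity_laplacian phi y <= infinity_laplacian psi y.
Proof.
move=> oO c1 c2 Oy ymax.
have [c3 p3 pp3] := C2_comb 1 (-1) oO c1 c2.
have [|D0 D2] := local_max_second_order oO c3 Oy.
  by apply: filterS ymax => x; rewrite !mul1r !mulN1r.
have pE i : partial i phi y = partial i psi y.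
  by have := D0 i; rewrite p3//; lra.
split; first by apply/rowP => i; rewrite !gradientE.
rewrite -subr_le0; apply: le_trans (D2 (gradient phi y)).
rewrite /infinity_laplacian -sumrB le_eqVlt; apply/orP; left; apply/eqP.
apply: eq_bigr => i _; rewrite -sumrB; apply: eq_bigr => j _.
rewrite (pp3 _ _ _ Oy) !gradientE !pE.
by move: (partial j (partial i phi) y) (partial j (partial i psi) y)
  (partial i psi y) (partial j psi y) => *; ring.
Qed.

End DirectionalDerivatives.

(** * Radial test functions *)

Section RadialFunctions.
Context {R : realType} {n : nat}.
Implicit Types (x y z : 'rV[R]_n) (O K N : set 'rV[R]_n) (phi w : 'rV[R]_n -> R).

Lemma compact_superlevel K w (a : R) : compact K ->
  (forall x, K x -> {for x, continuous w}) -> compact [set x | K x /\ a <= w x].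
Proof.
move=> cK cw; apply: (subclosed_compact _ cK); last by move=> x [].
have clK : closed K by apply: compact_closed => //; exact: norm_hausdorff.
apply: closed_cBP => x H.
have Kx : K x.
  by apply: clK; apply/closure_cBP => r /H[y [Ky _] yx]; exists y.
split=> //; rewrite leNgt; apply/negP => wa.
have e0 : 0 < (a - w x) / 2 by lra.
have /continuous_cBP/(_ _ e0)[d d0 dP] := cw _ Kx.
have [y [_ ay] /dP] := H _ d0; rewrite ler_norml => /andP[_].
lra.
Qed.

Lemma is_derive_coordB i j y z :
  is_derive y (delta_mx ord0 j : 'rV[R]_n) (fun x => x ord0 i - z ord0 i) (i == j)%:R.
Proof.
apply/is_derive_epsP => e e0; exists 1 => // h _; rewrite !mxE/=.
rewrite (_ : _ - _ - _ = 0) ?normr0 ?mulr_ge0 ?(ltW e0)//.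
by ring.
Qed.

Lemma is_derive_sqnormB j y z :
  is_derive y (delta_mx ord0 j : 'rV[R]_n) (fun x => sqnorm (x - z)) (2 * (y - z) ord0 j).
Proof.
apply/is_derive_epsP => e e0; exists e => // h he.
have dot_j : dot (y - z) (delta_mx ord0 j) = (y - z) ord0 j.
  rewrite /dot (bigD1 j)//= big1 => [|i ij]; first by rewrite [delta_mx _ _ _ _]mxE !eqxx mulr1 addr0.
  by rewrite [delta_mx _ _ _ _]mxE eqxx (negPf ij) mulr0.
have sq_j : sqnorm (delta_mx ord0 j : 'rV[R]_n) = 1.
  rewrite /sqnorm (bigD1 j)//= big1 => [|i ij]; first by rewrite mxE !eqxx expr1n addr0.
  by rewrite mxE eqxx (negPf ij) expr0n.
have -> : y + h *: delta_mx ord0 j - z = (y - z) + h *: (delta_mx ord0 j : 'rV[R]_n).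
  by rewrite addrAC.
rewrite sqnormD.
have -> : dot (y - z) (h *: delta_mx ord0 j) = h * (y - z) ord0 j.
  by rewrite -dot_j /dot mulr_sumr; apply: eq_bigr => i _; rewrite ![in LHS]mxE ![in RHS]mxE; ring.
rewrite -[sqnorm (h *: _)]enorm_sq enormZ exprMn enorm_sq sq_j mulr1 real_normK ?num_real//.
rewrite (_ : _ - _ - _ = h * h); last by ring.
by rewrite normrM ler_wpM2r.
Qed.

Lemma C0_coordB O i z : C0 O (fun x : 'rV[R]_n => x ord0 i - z ord0 i).
Proof.
move=> x _; apply/continuous_cBP => e e0; exists e => // y.
apply: le_trans; rewrite opprB addrA subrK.
by have := coord_le_enorm (y - x) i; rewrite !mxE.
Qed.

Section Profile.
Variables (O : set 'rV[R]_n) (z : 'rV[R]_n) (h h1 h2 : R -> R).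
Let q y := sqnorm (y - z).
Let phi y := h (q y).
Hypothesis oO : open O.
Hypothesis dh : forall y, O y -> is_derive (q y) 1 h (h1 (q y)).
Hypothesis dh1 : forall y, O y -> is_derive (q y) 1 h1 (h2 (q y)).
Hypothesis ch2 : forall y, O y -> {for q y, continuous h2}.

Let C0_comp (g : R -> R) : (forall y, O y -> {for q y, continuous g}) ->
  C0 O (fun y => g (q y)).
Proof.
move=> cg y Oy; apply: (@continuous_comp _ _ _ q g); first exact: sqnormB_continuous.
exact: cg.
Qed.

Let ex_continuous (g : R -> R) (x l : R) : is_derive x 1 g l -> {for x, continuous g}.
Proof. by case=> /derivable1_diffP dg _; exact: differentiable_continuous. Qed.

(** The profile depends on the squared distance, which is smooth at [z] as well; [h1] and [h2] are
    its derivatives in that variable, whence the factors 2 and 4. *)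
Lemma radial_C2 :
  [/\ C2 O phi, forall i y, O y -> partial i phi y = 2 * h1 (q y) * (y - z) ord0 i &
      forall i j y, O y -> partial j (partial i phi) y =
        4 * h2 (q y) * (y - z) ord0 i * (y - z) ord0 j + 2 * h1 (q y) * (i == j)%:R].
Proof.
have cq : C0 O phi by apply: C0_comp => y Oy; exact: ex_continuous (dh Oy).
have c1 : C0 O (fun y => h1 (q y)).
  by apply: C0_comp => y Oy; exact: ex_continuous (dh1 Oy).
have c2 : C0 O (fun y => h2 (q y)) by exact: C0_comp.
have cd i : C0 O (fun y => (y - z) ord0 i).
  have -> : (fun y => (y - z) ord0 i) = (fun y => y ord0 i - z ord0 i).
    by apply/funext => y; rewrite !mxE.
  exact: C0_coordB.
have ck (k : R) : C0 O (fun=> k) by move=> y _; exact: cst_continuous.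
have cM f g : C0 O f -> C0 O g -> C0 O (fun y => f y * g y).
  by move=> cf cg y Oy; apply: continuousM; [exact: cf | exact: cg].
have cD f g : C0 O f -> C0 O g -> C0 O (fun y => f y + g y).
  by move=> cf cg y Oy; apply: continuousD; [exact: cf | exact: cg].
apply: C2_intro => //.
- by move=> i; apply: (cM) => //; exact: cM.
- move=> i j; apply: (cD); apply: (cM).
  + by apply: (cM); [apply: (cM); [exact: ck | exact: c2] | exact: cd].
  + exact: cd.
  + by apply: (cM); [exact: ck | exact: c1].
  + exact: ck.
- move=> i y Oy; rewrite (_ : 2 * _ * _ = h1 (q y) * (2 * (y - z) ord0 i)); last by ring.
  by apply: (is_derive_chain _ (dh Oy)); exact: is_derive_sqnormB.
- move=> i j y Oy.
  have D1 : is_derive y (delta_mx ord0 j : 'rV[R]_n) (fun y => 2 * h1 (q y))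
      (2 * (h2 (q y) * (2 * (y - z) ord0 j))).
    apply: is_deriveZ; apply: is_derive_chain (dh1 Oy); exact: is_derive_sqnormB.
  have D2 : is_derive y (delta_mx ord0 j : 'rV[R]_n) (fun y => (y - z) ord0 i) (i == j)%:R.
    rewrite (_ : (fun y => _) = (fun y => y ord0 i - z ord0 i)).
      exact: is_derive_coordB.
    by apply/funext => x; rewrite !mxE.
  apply: is_derive_eq (is_deriveM D1 D2) _.
  by rewrite /GRing.scale/=; ring.
Qed.

Lemma radial_gradient y : O y -> gradient phi y = (2 * h1 (q y)) *: (y - z).
Proof.
have [_ p _] := radial_C2 => Oy.
by apply/rowP => i; rewrite gradientE p// [in RHS]mxE.
Qed.

(** With [d = y - z], the Hessian [4 h2 d d^T + 2 h1 I] is applied twice to the gradient [2 h1 d],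
    and [|d|^2 = q y]. *)
Lemma radial_infinity_laplacian y : O y -> infinity_laplacian phi y =
  8 * h1 (q y) ^+ 2 * q y * (2 * h2 (q y) * q y + h1 (q y)).
Proof.
have [_ p pp] := radial_C2 => Oy.
rewrite /infinity_laplacian.
set A := h1 (q y); set B := h2 (q y); pose d i := (y - z) ord0 i.
have qE : q y = \sum_(i < n) d i ^+ 2 by [].
transitivity (\sum_(i < n) (16 * B * A ^+ 2 * q y * d i ^+ 2 + 8 * A ^+ 3 * d i ^+ 2)).
  apply: eq_bigr => i _.
  have -> : 16 * B * A ^+ 2 * q y * d i ^+ 2 =
      \sum_(j < n) 16 * B * A ^+ 2 * d i ^+ 2 * d j ^+ 2.
    by rewrite -mulr_sumr -qE; ring.
  have -> : 8 * A ^+ 3 * d i ^+ 2 = \sum_(j < n) 8 * A ^+ 3 * d i * d j * (i == j)%:R.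
    rewrite (bigD1 i)//= eqxx big1 ?addr0; first by rewrite mulr1; ring.
    by move=> j ji; rewrite eq_sym (negPf ji) mulr0.
  rewrite -big_split/=; apply: eq_bigr => j _.
  by rewrite pp// !p// -/A -/B -/(d i) -/(d j); ring.
by rewrite big_split/= -!mulr_sumr -qE; ring.
Qed.

End Profile.

(** Positive away from [z], with vanishing gradient and Hessian at [z]: a squared distance would
    change the Hessian there. *)
Lemma quartic_C2 O z : open O -> let phi y := sqnorm (y - z) ^+ 2 in
  [/\ C2 O phi, O z -> forall i, partial i phi z = 0 &
      O z -> forall i j, partial j (partial i phi) z = 0].
Proof.
move=> oO phi.
have [||| c p pp] := @radial_C2 O z (fun q => q ^+ 2) (fun q => 2 * q) (fun=> 2) oO.
- move=> y _; set x0 := sqnorm _.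
  have -> : (fun q : R => q ^+ 2) = id * id by apply/funext => q; rewrite expr2.
  apply: is_derive_eq (is_deriveM (is_derive_id _ _) (is_derive_id _ _)) _.
  by rewrite /GRing.scale/=; ring.
- move=> y _; set x0 := sqnorm _.
  by apply: is_derive_eq (is_deriveZ 2 (is_derive_id _ _)) _; rewrite /GRing.scale/= mulr1.
- by move=> y _; exact: cst_continuous.
have q0 : sqnorm (z - z) = 0 by rewrite subrr -enorm_sq enorm0 expr0n.
have d0 j : (z - z) ord0 j = 0 by rewrite subrr mxE.
split=> // Oz i; first by rewrite p// d0 mulr0.
by move=> j; rewrite pp// q0 !d0 !mulr0 mul0r addr0.
Qed.

(* Cones for [k = g = 0]; smooth, and strict supersolutions away from [z], for
   [0 < k << g << b]. *)
Definition cone_fun (a b k g : R) z y : R :=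
  a + b * Num.sqrt (sqnorm (y - z) + k) - g * sqnorm (y - z).

(** The positivity hypothesis covers both a mollified vertex, [k > 0], and a true cone, [k = 0],
    with vertex off [O]. In the last factor, mollifying contributes the positive term with [k],
    which the concave term [- g] has to beat. *)
Lemma cone_funP O (a b k g : R) z : open O -> (forall y, O y -> 0 < sqnorm (y - z) + k) ->
  [/\ C2 O (cone_fun a b k g z),
   forall y, O y -> enorm (gradient (cone_fun a b k g z) y) =
     `|b / Num.sqrt (sqnorm (y - z) + k) - 2 * g| * enorm (y - z) &
   forall y, O y -> infinity_laplacian (cone_fun a b k g z) y =
     2 * (b / Num.sqrt (sqnorm (y - z) + k) - 2 * g) ^+ 2 * sqnorm (y - z) *
     (b * k / (2 * Num.sqrt (sqnorm (y - z) + k) ^+ 3) - g)].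
Proof.
move=> oO pos.
pose s (q : R) := Num.sqrt (q + k).
pose h (q : R) := a + b * s q - g * q.
pose h1 (q : R) := b / 2 * (s q)^-1 - g.
pose h2 (q : R) := - (b / 4) * ((s q)^-1 * ((s q)^-1 * (s q)^-1)).
have s0 y : O y -> 0 < s (sqnorm (y - z)) by move=> /pos; rewrite sqrtr_gt0.
have ds y : O y -> is_derive (sqnorm (y - z)) 1 s (2 * s (sqnorm (y - z)))^-1.
  move=> Oy; rewrite -[_^-1]mulr1; apply: (@is_derive1_chain _ (fun q => q + k) Num.sqrt).
    by apply: is_derive_eq (is_deriveD _ _) _; rewrite addr0.
  exact: is_derive1_sqrt (pos _ Oy).
have dh y : O y -> is_derive (sqnorm (y - z)) 1 h (h1 (sqnorm (y - z))).
  move=> Oy; have ds' := ds _ Oy; have sy := s0 _ Oy.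
  apply: is_derive_eq (is_deriveB (is_deriveD (is_derive_cst _ _ _) (is_deriveZ _ ds')) (is_deriveZ _ (is_derive_id _ _))) _.
  by rewrite /h1 /GRing.scale/=; field; rewrite gt_eqF.
have dh1 y : O y -> is_derive (sqnorm (y - z)) 1 h1 (h2 (sqnorm (y - z))).
  move=> Oy; have ds' := ds _ Oy; have sy := s0 _ Oy.
  have sn0 : s (sqnorm (y - z)) != 0 by rewrite gt_eqF.
  apply: is_derive_eq (is_deriveB (is_deriveZ _ (is_deriveV sn0 ds')) (is_derive_cst _ _ _)) _.
  by rewrite /h2 /GRing.scale/=; field.
have ch2 y : O y -> {for sqnorm (y - z), continuous h2}.
  move=> Oy; have ds' := ds _ Oy; have sy := s0 _ Oy.
  have sn0 : s (sqnorm (y - z)) != 0 by rewrite gt_eqF.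
  have cs : {for sqnorm (y - z), continuous (fun q => (s q)^-1)}.
    have [+ _] := is_deriveV sn0 ds'.
    by move=> /derivable1_diffP /differentiable_continuous.
  apply: continuousM; first exact: cst_continuous.
  by do 2 (apply: continuousM => //).
have [c _ _] := radial_C2 oO dh dh1 ch2.
split=> // y Oy; have sy := s0 _ Oy.
  rewrite (radial_gradient oO dh dh1 ch2 Oy) enormZ; congr (`|_| * _).
  by rewrite /h1 -/(s _); field; rewrite gt_eqF.
rewrite (radial_infinity_laplacian oO dh dh1 ch2 Oy).
have kE : k = s (sqnorm (y - z)) ^+ 2 - sqnorm (y - z).
  by rewrite sqr_sqrtr ?ltW ?pos//; ring.
rewrite -/(s _) [in RHS]kE /h1 /h2; field; by rewrite gt_eqF.
Qed.

End RadialFunctions.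

(** * Comparison with cones *)

Section Viscosity.
Context {R : realType} {n : nat}.
Implicit Types (x y z : 'rV[R]_n) (O D K N : set 'rV[R]_n).
Implicit Types (phi psi u v w : 'rV[R]_n -> R).

Definition sub_test O D u := forall x phi, O x -> C2 O phi ->
  (\forall y \near x, u y - phi y <= u x - phi x) ->
  0 <= infinity_laplacian phi x /\ \1_(interior D) x <= enorm (gradient phi x).

Definition super_test O D v := forall x phi, O x -> C2 O phi ->
  (\forall y \near x, v x - phi x <= v y - phi y) ->
  infinity_laplacian phi x <= 0 \/ enorm (gradient phi x) <= \1_(closure D) x.

Lemma min_ge0 (a b : R) : (0 <= Num.min a b) = (0 <= a) && (0 <= b).
Proof. exact: le_min. Qed.

(* Turns non-strict touching at [x] into strict touching. *)
Lemma quartic_perturbation O phi x (s : R) : open O -> O x -> C2 O phi ->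
  let psi y := 1 * phi y + s * sqnorm (y - x) ^+ 2 in
  [/\ C2 O psi, psi x = phi x, gradient psi x = gradient phi x &
      infinity_laplacian psi x = infinity_laplacian phi x].
Proof.
move=> oO Ox c psi; have [cq pq ppq] := quartic_C2 x oO.
have [cp p pp] := C2_comb 1 s oO c cq.
have pE i : partial i psi x = partial i phi x.
  by rewrite p// pq// mulr0 addr0 mul1r.
split=> //.
- by rewrite /psi subrr -enorm_sq enorm0 !expr0n mulr0 addr0 mul1r.
- by apply/rowP => i; rewrite !gradientE.
- apply: eq_bigr => i _; apply: eq_bigr => j _.
  by rewrite !pE pp// ppq// mulr0 addr0 mul1r.
Qed.

Lemma sqnormB_gt0 x y : y <> x -> 0 < sqnorm (y - x) ^+ 2.
Proof.
move=> /eqP yx; rewrite exprn_gt0// -enorm_sq exprn_gt0// enorm_gt0//.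
by rewrite subr_eq0.
Qed.

Lemma viscosity_sub_test O D u : open O -> viscosity_subsolution O D u -> sub_test O D u.
Proof.
move=> oO [_ H] x phi Ox c xmax.
have [cp psix gE lE] := quartic_perturbation 1 oO Ox c.
have := H x _ Ox cp; rewrite /min_operator gE lE min_ge0 subr_ge0 => /(_ _)/andP; apply.
rewrite /strict_local_max; apply: filterS xmax => y yx Oy /sqnormB_gt0 q0.
by rewrite psix; lra.
Qed.

Lemma viscosity_super_test O D v : open O -> viscosity_supersolution O D v -> super_test O D v.
Proof.
move=> oO [_ H] x phi Ox c xmin.
have [cp psix gE lE] := quartic_perturbation (-1) oO Ox c.
have := H x _ Ox cp; rewrite /min_operator gE lE ge_min subr_le0 => /(_ _)/orP; apply.
rewrite /strict_local_min; apply: filterS xmin => y yx Oy /sqnormB_gt0 q0.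
by rewrite psix; lra.
Qed.

(* Common form of both tests: [c = 0] for a subsolution [w], and for [w = - v]
   with [v] a supersolution, [c = 0] off the closure of [D] and [c = 1] in general. *)
Definition slope_test O N (c : R) w := forall x phi, N x -> C2 O phi ->
  (\forall y \near x, w y - phi y <= w x - phi x) ->
  0 <= infinity_laplacian phi x \/ enorm (gradient phi x) <= c.

Lemma sub_slope_test O D u N : N `<=` O -> sub_test O D u -> slope_test O N 0 u.
Proof. by move=> NO H x phi /NO Ox c /(H _ _ Ox c)[]; left. Qed.

Lemma infinity_laplacianN phi O x : open O -> O x -> C2 O phi ->
  [/\ C2 O (fun y => - phi y),
      enorm (gradient (fun y => - phi y) x) = enorm (gradient phi x) &
      infinity_laplacian (fun y => - phi y) x = - infinity_laplacian phi x].
Proof.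
move=> oO Ox c; have := C2_comb (-1) 0 oO c c.
have -> : (fun y => -1 * phi y + 0 * phi y) = (fun y => - phi y).
  by apply/funext => y; rewrite mulN1r mul0r addr0.
move=> [c2 p pp]; have pE i : partial i (fun y => - phi y) x = - partial i phi x.
  by rewrite p//; ring.
split; first exact: c2.
  have -> : gradient (fun y => - phi y) x = - gradient phi x.
    by apply/rowP => i; rewrite gradientE pE [RHS]mxE gradientE.
  exact: enormN.
rewrite /infinity_laplacian -sumrN; apply: eq_bigr => i _.
rewrite -sumrN; apply: eq_bigr => j _; rewrite !pE (pp _ _ _ Ox).
by move: (partial j (partial i phi) x) (partial i phi x) (partial j phi x) => *; ring.
Qed.

Lemma super_slope_test O D v N (c : R) : open O -> N `<=` O ->
  (forall x, N x -> \1_(closure D) x <= c) -> super_test O D v ->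
  slope_test O N c (fun x => - v x).
Proof.
move=> oO NO Nc H x phi Nx c2 xmax.
have Ox := NO _ Nx; have [c2N gN lN] := infinity_laplacianN oO Ox c2.
have [||] := H x (fun y => - phi y) Ox c2N.
- by apply: filterS xmax => y; lra.
- by rewrite lN oppr_le0; left.
- by rewrite gN => /le_trans h; right; apply: h; exact: Nc.
Qed.

(* The maximum of [w - T] for the strict supersolution
   [T = a + (b + d) sqrt(|y-z|^2 + t^2) - g |y-z|^2] would contradict the test. *)
Lemma cone_comparison O K N w (a b c : R) z : open O -> compact K -> K `<=` O ->
  C0 O w -> open N -> N `<=` K -> ~ N z -> slope_test O N c w -> 0 <= c <= b ->
  (forall y, K y -> ~ N y -> w y <= a + b * enorm (y - z)) ->
  forall y, K y -> w y <= a + b * enorm (y - z).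
Proof.
move=> oO cK KO cw oN NK Nz Ntest /andP[c0 cb] Kbd y0 Ky0.
rewrite leNgt; apply/negP => y0gt.
have b0 : 0 <= b by lra.
pose C y := a + b * enorm (y - z).
have cwC y : O y -> {for y, continuous (fun y => w y - C y)}.
  move=> Oy; apply: continuousB; first exact: cw.
  apply: continuousD; first exact: cst_continuous.
  apply: continuousM; first exact: cst_continuous.
  exact: enormB_continuous.
(* A third of the excess: on [K] the function [T] will lie between [C] and [C + e], so the maximum
   of [w - T] is at least [2 * e] and is reached in [K'], hence in [N]. *)
pose e := (w y0 - C y0) / 3.
have e0 : 0 < e by rewrite divr_gt0// subr_gt0.
have y0E : w y0 = C y0 + 3 * e by rewrite /e; field.
clearbody e.
pose K' := [set y | K y /\ e <= w y - C y].
have cK' : compact K' by apply: compact_superlevel => // y /KO; exact: cwC.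
have K'N y : K' y -> N y.
  move=> [Ky eC]; apply: contrapT => /(Kbd _ Ky); rewrite -/(C y); lra.
have [M M0 KM] : exists2 M, 0 < M & forall y, K y -> `|enorm (y - z)| <= M.
  by apply: compact_bound => // y _; exact: enormB_continuous.
(* The set [K'] stays away from the vertex because [N] does not contain it. *)
have [r r0 K'r] : exists2 r, 0 < r & forall y, K' y -> r <= enorm (y - z).
  have [| |r r0 K'r] := @compact_lt_gap _ _ K' (fun y => - enorm (y - z)) 0 cK'.
  - by move=> y _; apply: continuousN; exact: enormB_continuous.
  - move=> y /K'N Ny; rewrite oppr_lt0 enorm_gt0// subr_eq0; apply: contra_notN Nz.
    by move=> /eqP <-.
  - by exists r => // y /K'r; lra.
(* Over [K] the surplus slope [d] raises the cone by at most [e / 2]; as [g * M = d / 8], the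
   quadratic term takes back only part of that surplus. *)
pose d := e / (2 * M); have d0 : 0 < d by rewrite divr_gt0// mulr_gt0.
pose g := d / (8 * M); have g0 : 0 < g by rewrite divr_gt0// mulr_gt0.
have bd0 : 0 < b + d by rewrite ltr_wpDl.
have dM : d * M = e / 2 by rewrite /d; field; rewrite gt_eqF.
have gM : g * M = d / 8 by rewrite /g; field; rewrite gt_eqF.
clearbody g; clearbody d.
(* The four bounds give, in order: a height error of at most [e / 2]; a slope loss of at most
   [d / 4] beyond distance [r]; [t ^+ 2 <= t]; a mollification term in the Laplacian smaller than
   [g]. *)
pose t := Num.min (e / (2 * (b + d))) (Num.min (d * r / (4 * (b + d))) (Num.min 1 (g * r ^+ 3 / (b + d)))).
have t0 : 0 < t.
  by rewrite !lt_min; apply/and4P; split => //; do ?[apply: divr_gt0 | apply: mulr_gt0 | apply: exprn_gt0].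
have [t1 t2 t3 t4] : [/\ (b + d) * t <= e / 2, (b + d) * t <= d * r / 4, t <= 1 & (b + d) * t <= g * r ^+ 3].
  have : t <= t by []; rewrite {2}/t !le_min => /and4P[h1 h2 h3 h4].
  split=> //.
  - by move: h1; rewrite ler_pdivlMr ?mulr_gt0//; lra.
  - by move: h2; rewrite ler_pdivlMr ?mulr_gt0//; lra.
  - by move: h4; rewrite ler_pdivlMr//; lra.
pose T := cone_fun a (b + d) (t ^+ 2) g z.
have t20 : 0 < t ^+ 2 by rewrite exprn_gt0.
have [c2 Tg Tl] : [/\ C2 O T, _ & _] :=
  cone_funP a (b + d) g oO (fun y _ => ltr_wpDl (sqnorm_ge0 (y - z)) t20).
have sE y : Num.sqrt (sqnorm (y - z) + t ^+ 2) ^+ 2 = enorm (y - z) ^+ 2 + t ^+ 2.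
  by rewrite sqr_sqrtr ?enorm_sq// addr_ge0 ?sqnorm_ge0 ?ltW.
have s_bd y : enorm (y - z) <= Num.sqrt (sqnorm (y - z) + t ^+ 2) <= enorm (y - z) + t.
  have := sE y; have := enorm_ge0 (y - z).
  have := sqrtr_ge0 (sqnorm (y - z) + t ^+ 2).
  set s := Num.sqrt _; set q := enorm _ => s0 q0 E; apply/andP; split.
    by rewrite -ler_sqr ?nnegrE// E; lra.
  rewrite -ler_sqr ?nnegrE ?addr_ge0 ?(ltW t0)// E sqrrD.
  have : 0 <= q * t by rewrite mulr_ge0// ltW.
  by lra.
have T_up y : K y -> T y <= C y + e.
  move=> /KM; rewrite ger0_norm ?enorm_ge0// => qM; have /andP[_] := s_bd y.
  rewrite /T /cone_fun /C -enorm_sq; set s := Num.sqrt _; set q := enorm _ => sq.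
  have : (b + d) * s <= (b + d) * (q + t) by rewrite ler_pM2l.
  have : d * q <= d * M by rewrite ler_pM2l.
  have : 0 <= g * q ^+ 2 by rewrite mulr_ge0 ?sqr_ge0 ?ltW.
  by lra.
have T_lo y : K y -> C y <= T y.
  move=> /KM; rewrite ger0_norm ?enorm_ge0// => qM; have /andP[+ _] := s_bd y.
  have := enorm_ge0 (y - z).
  rewrite /T /cone_fun /C -enorm_sq; set s := Num.sqrt _; set q := enorm _ => q0 sq.
  have : (b + d) * q <= (b + d) * s by rewrite ler_pM2l.
  have : g * q ^+ 2 <= d * q.
    rewrite expr2 mulrA ler_wpM2r//; apply: (@le_trans _ _ (g * M)).
      by rewrite ler_pM2l.
    by lra.
  by lra.
have [y1 Ky1 y1max] : exists2 y1, K y1 & forall y, K y -> w y - T y <= w y1 - T y1.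
  apply: compact_argmax => //; first by exists y0.
  by move=> y /KO Oy; apply: continuousB; [exact: cw | exact: C2_C0 c2 _ Oy].
have y1e : 2 * e <= w y1 - T y1.
  by apply: le_trans (y1max _ Ky0); have := T_up _ Ky0; lra.
have K'y1 : K' y1 by split=> //; have := T_lo _ Ky1; lra.
have Ny1 := K'N _ K'y1; have Oy1 := KO _ Ky1.
have y1loc : \forall y \near y1, w y - T y <= w y1 - T y1.
  by apply: filterS (open_nbhs_nbhs (conj oN Ny1)) => y /NK; exact: y1max.
have := Ntest _ _ Ny1 c2 y1loc; rewrite Tl// Tg//.
have := K'r _ K'y1; have /andP[] := s_bd y1; have := KM _ Ky1.
have := enorm_ge0 (y1 - z); rewrite -enorm_sq.
set s := Num.sqrt _; set q := enorm _ => q0; rewrite ger0_norm// => qM qs sq rq.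
have s0 : 0 < s by lra.
have qp : 0 < q by lra.
have slope : c < ((b + d) / s - 2 * g) * q.
  have : (b + d) / s * q >= (b + d) - (b + d) * t / r.
    have -> : (b + d) / s * q = (b + d) - (b + d) * (s - q) / s by field; rewrite gt_eqF.
    rewrite lerD2l lerN2 -!mulrA ler_pM2l//.
    apply: (@le_trans _ _ (t / s)).
      by rewrite ler_pM2r ?invr_gt0//; lra.
    by rewrite ler_pM2l// lef_pV2 ?posrE//; lra.
  have : (b + d) * t / r <= d / 4.
    by rewrite ler_pdivrMr//; lra.
  have : g * q <= g * M by rewrite ler_pM2l.
  rewrite mulrBl; lra.
have pos : 0 < (b + d) / s - 2 * g.
  by rewrite -(pmulr_lgt0 _ qp); lra.
have lap : (b + d) * t ^+ 2 / (2 * s ^+ 3) < g.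
  rewrite ltr_pdivrMr ?mulr_gt0 ?exprn_gt0//.
  have : (b + d) * t ^+ 2 <= (b + d) * t.
    by rewrite ler_pM2l// expr2 ler_piMr// ltW.
  have rs : r <= s by lra.
  have : g * r ^+ 3 <= g * s ^+ 3.
    by rewrite ler_pM2l// lerXn2r ?nnegrE// ltW.
  have : 0 < g * r ^+ 3 by rewrite mulr_gt0 ?exprn_gt0.
  by lra.
case; last by rewrite ger0_norm ?(ltW pos)// leNgt slope.
rewrite leNgt => /negP; apply.
have pos' : 0 < 2 * ((b + d) / s - 2 * g) ^+ 2 * q ^+ 2.
  by do ?[apply: mulr_gt0 | apply: exprn_gt0].
by rewrite (pmulr_rlt0 _ pos') subr_lt0.
Qed.

Lemma closed_cB x (r : R) : closed (cB x r).
Proof. by apply: compact_closed; [exact: norm_hausdorff | exact: compact_cB]. Qed.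

Lemma open_oB x (r : R) : open [set y | enorm (y - x) < r].
Proof.
move=> y /= yx; apply/nbhs_cBP; exists ((r - enorm (y - x)) / 2); first by lra.
by move=> y' /=; rewrite /cB/= => y'y; have := enorm_tri y y' x; lra.
Qed.

Lemma open_punctured x (r : R) : open [set y | enorm (y - x) < r /\ y <> x].
Proof.
have -> : [set y | enorm (y - x) < r /\ y <> x] = [set y | enorm (y - x) < r] `&` ~` [set x] by [].
apply: openI; [exact: open_oB | apply: closed_openC].
by apply: compact_closed; [exact: norm_hausdorff | exact: compact_set1].
Qed.

(** Cone comparison on the punctured ball: the cone equals [w] at its vertex, where it is not
    smooth, and dominates [w] on the sphere by [bd]. *)
Lemma ball_cone_bound O w x (r c b : R) : open O -> C0 O w -> 0 < r -> cB x r `<=` O ->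
  slope_test O (cB x r) c w -> 0 <= c <= b ->
  (forall y, cB x r y -> w y <= w x + b * r) ->
  forall y, cB x r y -> w y <= w x + b * enorm (y - x).
Proof.
move=> oO cw r0 BO test cb bd.
apply: (@cone_comparison O (cB x r) [set y | enorm (y - x) < r /\ y <> x] w _ _ c) => //.
- exact: compact_cB.
- exact: open_punctured.
- by move=> y [/ltW].
- by case.
- by move=> y phi [/ltW yr _]; exact: test.
- move=> y yx; rewrite not_andP => -[/negP|/contrapT->]; last first.
    by rewrite subrr enorm0 mulr0 addr0.
  rewrite -leNgt => ry; have -> : enorm (y - x) = r by apply/le_anti/andP.
  exact: bd.
Qed.

(* A touching cone [u(x) + b |y - x|], [b < 1], mollified at its vertex, has
   slope below [1] everywhere. *)
Lemma sub_slope_interior O D u x (r : R) : open O -> C0 O u -> sub_test O D u ->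
  0 < r -> cB x r `<=` O -> cB x r `<=` interior D ->
  exists2 y, cB x r y & u x + r <= u y.
Proof.
move=> oO cu H r0 BO BD; apply: contrapT => no.
have [|y|e e0 gap] := @compact_lt_gap _ _ (cB x r) u (u x + r) (@compact_cB _ _ x r).
- by move=> y /BO; exact: cu.
- by move=> Bx; rewrite ltNge; apply/negP => ?; apply: no; exists y.
(* Below one, yet [b * r > r - e]: on the sphere, where [u] is at most [u x + r - e], the cone is
   strictly above [u]. *)
pose b := 1 - Num.min 1 (e / r) / 2.
have er : 0 < e / r by rewrite divr_gt0.
have m0 : 0 < Num.min 1 (e / r) by rewrite lt_min ltr01.
have b1 : b < 1 by rewrite /b; lra.
have b0 : 0 < b.
  have : Num.min 1 (e / r) <= 1 by rewrite ge_min lexx.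
  by rewrite /b; lra.
have br : (r - e) < b * r.
  have : Num.min 1 (e / r) <= e / r by rewrite ge_min lexx orbT.
  rewrite ler_pdivlMr// => h; have : 0 < Num.min 1 (e / r) * r by rewrite mulr_gt0.
  by rewrite /b mulrBl; lra.
(* Mollifying lifts the vertex by [b * t], little enough to keep the maximum of [u - T] off the
   sphere. *)
pose t := (b * r - (r - e)) / (2 * b).
have t0 : 0 < t by rewrite divr_gt0 ?mulr_gt0// subr_gt0.
have bt : b * t < b * r - (r - e).
  by rewrite /t; have -> : b * ((b * r - (r - e)) / (2 * b)) = (b * r - (r - e)) / 2; [field; rewrite gt_eqF|lra].
have t20 : 0 < t ^+ 2 by rewrite exprn_gt0.
have [c2 Tg _] := cone_funP (u x) b 0 oO (fun y _ => ltr_wpDl (sqnorm_ge0 (y - x)) t20).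
set T := cone_fun _ _ _ _ _ in c2 Tg.
have TE y : T y = u x + b * Num.sqrt (sqnorm (y - x) + t ^+ 2).
  by rewrite /T /cone_fun mul0r subr0.
have [y1 By1 y1max] : exists2 y1, cB x r y1 & forall y, cB x r y -> u y - T y <= u y1 - T y1.
  apply: compact_argmax; first exact: compact_cB.
    by exists x; apply: cBxx; rewrite ltW.
  by move=> y /BO Oy; apply: continuousB; [exact: cu | exact: C2_C0 c2 _ Oy].
have y1r : enorm (y1 - x) < r.
  rewrite ltNge; apply/negP => ry1.
  have := y1max x (cBxx x (ltW r0)); rewrite !TE subrr -[sqnorm 0]enorm_sq enorm0 expr0n add0r.
  rewrite sqrtr_sqr ger0_norm ?(ltW t0)//.
  have : b * r <= b * Num.sqrt (sqnorm (y1 - x) + t ^+ 2).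
    rewrite ler_pM2l// -[leLHS]ger0_norm ?(ltW r0)// -sqrtr_sqr ler_wsqrtr// -enorm_sq.
    have : r ^+ 2 <= enorm (y1 - x) ^+ 2 by rewrite ler_sqr ?nnegrE ?enorm_ge0 ?(ltW r0).
    by lra.
  by have := gap _ By1; lra.
have y1loc : \forall y \near y1, u y - T y <= u y1 - T y1.
  apply: filterS (open_nbhs_nbhs (conj (@open_oB x r) y1r)) => y /= yr.
  exact/y1max/ltW.
have [_] := H _ _ (BO _ By1) c2 y1loc; rewrite Tg; last exact: BO.
rewrite indicE mem_set; last exact: BD.
apply/negP; rewrite -ltNge mulr0 subr0.
set s := Num.sqrt _.
have s0 : 0 < s by rewrite sqrtr_gt0 ltr_wpDl// sqnorm_ge0.
have qs : enorm (y1 - x) <= s by rewrite /s /enorm -/(sqnorm _) ler_wsqrtr// lerDl ltW.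
rewrite ger0_norm; last by rewrite divr_ge0// ltW.
rewrite mulrAC ltr_pdivrMr// mul1r; apply: (@le_lt_trans _ _ (b * s)).
  by rewrite ler_pM2l.
by rewrite gtr_pMl.
Qed.

(** Slope one is available only on small balls inside [interior D]; comparison with a cone carries
    it to a large ball, which may leave [D]. The loss [e] pays for moving the centre from [x] to a
    nearby interior point. *)
Lemma sub_slope_ge1 O D u x (r : R) : open O -> C0 O u -> sub_test O D u ->
  closure (interior D) = closure D -> closure D x ->
  0 < r -> cB x r `<=` O -> forall e, 0 < e ->
  exists2 y, cB x r y & u x + r - e <= u y.
Proof.
move=> oO cu H Dreg Dx r0 BO e e0.
have Ox : O x by apply/BO/cBxx/ltW.
have e2 : 0 < e / 2 by lra.
have /continuous_cBP/(_ _ e2)[d d0 dP] := cu _ Ox.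
pose s := Num.min d (Num.min (e / 2) (r / 2)).
have s0 : 0 < s by rewrite !lt_min d0; lra.
have [sd se sr] : [/\ s <= d, s <= e / 2 & s <= r / 2].
  by have : s <= s by []; rewrite {2}/s !le_min => /and3P[].
rewrite -Dreg in Dx; have [x' Dx' xx'] := iffLR (closure_cBP _ _) Dx _ s0.
have BO' : cB x' (r - s) `<=` O.
  by move=> y /(cB_trans xx'); rewrite addrC subrK => /BO.
have [p p0 pP] := open_cBP (@open_interior _ D) Dx'.
pose p' := Num.min p (r - s).
have p'0 : 0 < p' by rewrite lt_min p0; lra.
have [p'p p'r] : p' <= p /\ p' <= r - s.
  by have : p' <= p' by []; rewrite {2}/p' le_min => /andP[].
have [y1 y1x' y1u] : exists2 y, cB x' p' y & u x' + p' <= u y.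
  apply: (sub_slope_interior oO cu H) => //.
    by move=> y yx'; apply/BO'/(cB_le p'r).
  by move=> y yx'; apply/pP/(cB_le p'p).
have [y2 y2x' y2max] : exists2 y2, cB x' (r - s) y2 & forall y, cB x' (r - s) y -> u y <= u y2.
  apply: compact_argmax; first exact: compact_cB.
    by exists x'; apply: cBxx; lra.
  by move=> y /BO'; exact: cu.
have y2u : u x' + (r - s) <= u y2.
  (* A rise of [p'] at distance at most [p'] from [x'] forces this cone slope to be at least one. *)
  pose b := (u y2 - u x') / (r - s).
  have rs0 : 0 < r - s by lra.
  have b0 : 0 <= b.
    by rewrite divr_ge0 ?(ltW rs0)// subr_ge0 y2max//; apply: cBxx; rewrite ltW.
  have bE : b * (r - s) = u y2 - u x' by rewrite divfK// gt_eqF.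
  have test : slope_test O (cB x' (r - s)) 0 u by exact: sub_slope_test H.
  have := ball_cone_bound oO cu rs0 BO' test (_ : 0 <= 0 <= b).
  rewrite lexx b0 => /(_ isT).
  have bd y : cB x' (r - s) y -> u y <= u x' + b * (r - s).
    by move=> /y2max; rewrite bE; lra.
  move=> /(_ bd y1 (cB_le p'r y1x')) h.
  have : b * enorm (y1 - x') <= b * p' by rewrite ler_wpM2l.
  move=> h'; have bp : p' <= b * p' by lra.
  have b1 : 1 <= b by rewrite -(ler_pM2r p'0) mul1r.
  have : (r - s) <= b * (r - s) by rewrite ler_peMl// ltW.
  by lra.
exists y2.
  by have := cB_trans xx' y2x'; rewrite addrC subrK.
have := dP x' (cB_le sd xx'); rewrite ler_norml => /andP[h _].
by lra.
Qed.

End Viscosity.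

(** * Maxima over balls *)

Section BallMax.
Context {R : realType} {n : nat}.
Implicit Types (x y z : 'rV[R]_n) (O A G K : set 'rV[R]_n) (u v w : 'rV[R]_n -> R).
Implicit Types (s t e : R).

Definition bmax w s x : R := sup (w @` cB x s).

Lemma bmaxP O w s x : C0 O w -> 0 <= s -> cB x s `<=` O ->
  (forall y, cB x s y -> w y <= bmax w s x) /\
  exists2 y, cB x s y & w y = bmax w s x.
Proof.
move=> cw s0 BO.
have [y By ymax] : exists2 y, cB x s y & forall z, cB x s z -> w z <= w y.
  apply: compact_argmax; first exact: compact_cB.
    by exists x; exact: cBxx.
  by move=> y /BO; exact: cw.
have yE : w y = bmax w s x.
  apply/eqP; rewrite eq_le; apply/andP; split.
    apply: sup_upper_bound; last by exists y.
    by split; [exists (w y), y | exists (w y) => _ [z Bz <-]; exact: ymax].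
  by apply: ge_sup; [exists (w y), y | move=> _ [z Bz <-]; exact: ymax].
by split; [move=> z Bz; rewrite -yE; exact: ymax | exists y].
Qed.

Lemma bmax_ge O w s x y : C0 O w -> cB x s `<=` O -> cB x s y -> w y <= bmax w s x.
Proof.
move=> cw BO yx; have s0 : 0 <= s by apply: le_trans yx; exact: enorm_ge0.
by have [+ _] := bmaxP cw s0 BO; apply.
Qed.

Lemma bmax_le O w s x a : C0 O w -> 0 <= s -> cB x s `<=` O ->
  (forall y, cB x s y -> w y <= a) -> bmax w s x <= a.
Proof. by move=> cw s0 BO H; have [_ [y /H + <-]] := bmaxP cw s0 BO. Qed.

Lemma bmax0 O w x : C0 O w -> O x -> bmax w 0 x = w x.
Proof.
move=> cw Ox.
have B0 y : cB x 0 y -> y = x.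
  rewrite /cB/= => yx; apply/eqP; rewrite -subr_eq0; apply/eqP/enorm_eq0.
  by apply/le_anti; rewrite yx enorm_ge0.
have BO : cB x 0 `<=` O by move=> y /B0->.
by have [_ [y /B0-> ->]] := bmaxP cw (lexx 0) BO.
Qed.

Lemma bmax_sub O w s t x y : C0 O w -> 0 <= s -> cB y t `<=` O ->
  cB x s `<=` cB y t -> bmax w s x <= bmax w t y.
Proof.
move=> cw s0 BO BB; apply: (bmax_le cw s0).
  by move=> z /BB/BO.
by move=> z /BB; exact: (bmax_ge cw BO).
Qed.

Lemma bmax_semigroup O w s t x : C0 O w -> 0 <= s -> 0 <= t -> cB x (t + s) `<=` O ->
  exists2 y, cB x t y & bmax w s y = bmax w (t + s) x.
Proof.
move=> cw s0 t0 BO; have [_ [q qx qE]] := bmaxP cw (addr_ge0 t0 s0) BO.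
have [y yx qy] := cB_split t0 s0 qx.
have BB : cB y s `<=` cB x (t + s) by move=> z; exact: cB_trans.
exists y => //; apply/eqP; rewrite eq_le (bmax_sub cw s0 BO BB) -qE.
by apply: (bmax_ge cw) => // z /BB/BO.
Qed.

(** The cone at [x] with slope the larger of [c] and the mean slope over radius [2 e] is read at
    radius [e]. So either the first increment is at most the second, or it is at most [c * e]. *)
Lemma bmax_half O w e x (c : R) : open O -> C0 O w -> 0 < e -> cB x (e + e) `<=` O ->
  slope_test O (cB x (e + e)) c w -> 0 <= c ->
  bmax w e x - w x <= Num.max ((bmax w (e + e) x - w x) / 2) (c * e).
Proof.
move=> oO cw e0 BO test c0.
pose b := Num.max ((bmax w (e + e) x - w x) / (2 * e)) c.
have cb : 0 <= c <= b by rewrite c0 le_max lexx orbT.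
have e20 : 0 < e + e by rewrite addr_gt0.
have bE : b * e = Num.max ((bmax w (e + e) x - w x) / 2) (c * e).
  rewrite /b maxr_pMl ?(ltW e0)//; congr Num.max.
  by field; rewrite gt_eqF.
rewrite -bE lerBlDl; apply: (bmax_le cw (ltW e0)).
  by move=> y /(@cB_le _ _ _ _ (e + e)) yx; apply/BO/yx; rewrite lerDl ltW.
move=> y yx.
have yx2 : cB x (e + e) y by apply: (@cB_le _ _ _ e) yx; rewrite lerDl ltW.
apply: (@le_trans _ _ (w x + b * enorm (y - x))).
  apply: (ball_cone_bound oO cw e20 BO test cb) => // z zx.
  apply: le_trans (bmax_ge cw BO zx) _; rewrite mulrDr bE -lerBlDl.
  have : (bmax w (e + e) x - w x) / 2 <= Num.max ((bmax w (e + e) x - w x) / 2) (c * e).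
    by rewrite le_max lexx.
  by lra.
by rewrite lerD2l ler_wpM2l//; case/andP: cb => h; apply: le_trans.
Qed.

(** [bmax_half] is applied at a point [y] within [s] of [x] whose [e]-ball realizes the maximum over
    radius [s + e]; there [w y] is at most [bmax w s x]. *)
Lemma bmax_convex O w s e x : open O -> C0 O w -> slope_test O O 0 w ->
  0 <= s -> 0 < e -> cB x (s + (e + e)) `<=` O ->
  2 * bmax w (s + e) x <= bmax w s x + bmax w (s + (e + e)) x.
Proof.
move=> oO cw test s0 e0 BO.
have BO1 : cB x (s + e) `<=` O.
  by move=> y yx; apply: BO; apply: (cB_le _ yx); lra.
have BO0 : cB x s `<=` O.
  by move=> y yx; apply: BO; apply: (cB_le _ yx); lra.
have [y yx yE] := bmax_semigroup cw (ltW e0) s0 BO1.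
have BB : cB y (e + e) `<=` cB x (s + (e + e)) by move=> z; exact: cB_trans.
have yO : cB y (e + e) `<=` O by move=> z /BB/BO.
have test' : slope_test O (cB y (e + e)) 0 w by move=> z phi /yO; exact: test.
have := bmax_half oO cw e0 yO test' (lexx 0); rewrite mul0r.
have h1 := bmax_sub cw (addr_ge0 (ltW e0) (ltW e0)) BO BB.
have h2 := bmax_ge cw BO0 yx.
have h3 : w y <= bmax w (e + e) y by apply: (bmax_ge cw yO); apply: cBxx; lra.
rewrite max_l; last by rewrite divr_ge0// subr_ge0.
by rewrite yE; lra.
Qed.

(** Translating one ball onto the other compares [w] only at points that differ by the shift of the
    centre, so a Lipschitz bound at distances up to [d] suffices. *)
Lemma bmax_continuous O A w s (d L : R) x : C0 O w -> 0 <= s -> 0 < d -> 0 < L ->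
  A `<=` O -> cB x (s + d) `<=` A ->
  (forall p q, A p -> A q -> cB p d q -> w q <= w p + L * enorm (q - p)) ->
  {for x, continuous (bmax w s)}.
Proof.
move=> cw s0 d0 L0 AO BA lip; apply/continuous_cBP => e e0.
exists (Num.min d (e / L)); first by rewrite lt_min d0 divr_gt0.
move=> y; rewrite /cB/= le_min => /andP[yd]; rewrite ler_pdivlMr// => ye.
have BxA : cB x s `<=` A by move=> z zx; apply/BA/(cB_le _ zx); rewrite lerDl ltW.
have ByA : cB y s `<=` A.
  by move=> z /(cB_trans (yd : cB x d y)); rewrite addrC => /BA.
have BxO : cB x s `<=` O by move=> z /BxA/AO.
have ByO : cB y s `<=` O by move=> z /ByA/AO.
have shift p q : enorm (p - q) <= d -> L * enorm (p - q) <= e ->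
    cB p s `<=` A -> cB q s `<=` A -> bmax w s q <= bmax w s p + e.
  move=> pd pe pA qA; apply: (bmax_le cw s0); first by move=> z /qA/AO.
  move=> z zq; pose z' := z + (p - q).
  have zz' : z - z' = q - p by rewrite /z' opprD addrA subrr add0r opprB.
  have z'p : cB p s z' by rewrite /cB/= /z' [p - q]addrC addrA addrK.
  have z'z : cB z' d z by rewrite /cB/= zz' enormB.
  apply: le_trans (lip _ _ (pA _ z'p) (qA _ zq) z'z) _.
  rewrite zz' (enormB q p); apply: lerD => //.
  by apply: (bmax_ge cw) => // z1 /pA/AO.
rewrite ler_norml; apply/andP; split.
  have := shift y x yd; rewrite mulrC => /(_ ye ByA BxA); lra.
have := shift x y; rewrite (enormB x y) mulrC => /(_ yd ye BxA ByA); lra.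
Qed.

(** By convexity the last increment dominates all earlier ones, hence their mean; this turns an
    average slope into a slope at the outer radius. *)
Lemma convex_slope (a : nat -> R) N :
  (forall k, (k < N)%N -> 2 * a k.+1 <= a k + a k.+2) ->
  a N - a 0 <= N%:R * (a N.+1 - a N).
Proof.
elim: N => [|N IH] H; first by rewrite subrr mul0r.
have {}IH := IH (fun k kN => H k (ltnW kN)).
have := H N (ltnSn N) => h.
have : N.+1%:R * (a N.+1 - a N) <= N.+1%:R * (a N.+2 - a N.+1).
  by rewrite ler_pM2l ?ltr0n//; lra.
rewrite {1}[N.+1%:R]mulrSr mulrDl mul1r; lra.
Qed.

(* Armstrong-Smart: the points of [G] maximizing [U] among those maximizing
   [U + W] form a set stable under steps of length [e], hence unbounded. *)
Lemma discrete_comparison (n_gt0 : (0 < n)%N) (U W : 'rV[R]_n -> R) G K e x0 :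
  0 < e -> compact G -> (forall x, G x -> {for x, continuous U}) ->
  (forall x, G x -> {for x, continuous W}) -> G x0 ->
  (exists M, forall x, K x -> enorm x <= M) ->
  (forall x, K x -> cB x e `<=` G) ->
  (forall x, G x -> ~ K x -> U x + W x < U x0 + W x0) ->
  (forall x, K x -> exists Ap Am Bp Bm,
    [/\ exists2 y, cB x e y & U y = U x + Ap,
        forall y, cB x e y -> U x - Am <= U y,
        exists2 y, cB x e y & W y = W x + Bp &
        forall y, cB x e y -> W x - Bm <= W y] /\
    [/\ 0 <= Ap, Am <= Ap & Bm <= Bp \/ Bm <= e /\ e <= Ap]) -> False.
Proof.
move=> e0 cG cU cW Gx0 [M KM] KG out step.
have cUW x : G x -> {for x, continuous (fun x => U x + W x)}.
  by move=> Gx; apply: continuousD; [exact: cU | exact: cW].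
have [x1 Gx1 x1max] := compact_argmax cG (ex_intro _ _ Gx0) cUW.
pose E := [set x | G x /\ U x1 + W x1 <= U x + W x].
have cE : compact E by exact: compact_superlevel.
have [x2 Ex2 x2max] : exists2 x, E x & forall y, E y -> U y <= U x.
  apply: compact_argmax => //; first by exists x1.
  by move=> x [/cU].
have EK x : E x -> K x.
  move=> [Gx Ex]; apply: contrapT => /(out _ Gx).
  by have := x1max _ Gx0; lra.
have stable x : E x -> U x = U x2 -> forall y, cB x e y -> E y /\ U y = U x2.
  move=> Ex Ux y yx; have Kx := EK _ Ex.
  have [Ap [Am [Bp [Bm [[[p px Up] HAm [q qx Wq] HBm] [Ap0 AA BB]]]]]] := step x Kx.
  have Gmax z : cB x e z -> U z + W z <= U x + W x.
    by move=> /(KG _ Kx)/x1max; have [_] := Ex; lra.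
  have Ey z : cB x e z -> U x + W x <= U z + W z -> E z.
    by move=> zx; have [_ Ex'] := Ex => h; split; [exact: KG zx | lra].
  have h1 := Gmax p px; have h2 := HBm p px.
  have h3 := Gmax q qx; have h4 := HAm q qx.
  (* Maximality at [p] and [q] gives [Ap <= Bm] and [Bp <= Am]; each alternative for [Bm] closes the
     circle. Then [p] also maximizes the sum, so the choice of [x2] forces [Ap = 0]. *)
  have AB : Ap = Bm by case: BB => [?|[? ?]]; apply/le_anti/andP; split; lra.
  have Ep : E p by apply: Ey => //; lra.
  have h5 := x2max _ Ep.
  have Ap_0 : Ap = 0 by apply/le_anti/andP; split; lra.
  have Am0 : Am <= 0 by lra.
  have h6 := HAm y yx; have h7 := HBm y yx.
  have Ey' : E y by apply: Ey => //; lra.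
  split=> //; apply/le_anti; rewrite x2max//=; lra.
(* Repeated steps of length [e] in one coordinate direction stay among these points and leave every
   bounded set. *)
pose i0 := Ordinal n_gt0.
pose v : 'rV[R]_n := e *: delta_mx ord0 i0.
have dd : enorm (delta_mx ord0 i0 : 'rV[R]_n) = 1.
  rewrite /enorm (bigD1 i0)//= big1 => [|j ji]; first by rewrite mxE !eqxx expr1n addr0 sqrtr1.
  by rewrite mxE eqxx (negPf ji) expr0n.
have ve : enorm v = e by rewrite /v enormZ dd mulr1 gtr0_norm.
have iter k : E (x2 + k%:R *: v) /\ U (x2 + k%:R *: v) = U x2.
  elim: k => [|k [Ek Uk]]; first by rewrite scale0r addr0.
  apply: (stable (x2 + k%:R *: v)) => //.
  have -> : x2 + k.+1%:R *: v = v + (x2 + k%:R *: v).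
    by rewrite mulrSr scalerDl scale1r addrA addrC.
  by rewrite /cB/= addrK ve.
have [k kM] : exists k : nat, (M + enorm x2) / e < k%:R.
  by exists (Num.truncn ((M + enorm x2) / e)).+1; exact: truncnS_gt.
have [/EK/KM h _] := iter k.
have := enormD (x2 + k%:R *: v) (- x2).
rewrite addrAC subrr add0r enormZ enormN ve ger0_norm//.
by move: kM; rewrite ltr_pdivrMr//; lra.
Qed.

End BallMax.

(** * Comparison principle *)

Section Comparison.
Context {R : realType} {n : nat}.
Implicit Types (x y z : 'rV[R]_n) (O D A G K : set 'rV[R]_n) (u v w : 'rV[R]_n -> R).
Implicit Types (s t e : R).

(** A cone of slope [2 * F / r] covers the oscillation of [w] on the ball; the extra 1 makes the
    slope admissible for [c = 1]. *)
Lemma slope_test_lipschitz O w F r p q : open O -> C0 O w -> slope_test O O 1 w ->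
  0 < r -> cB p r `<=` O -> (forall y, cB p r y -> `|w y| <= F) -> cB p r q ->
  w q <= w p + (2 * F / r + 1) * enorm (q - p).
Proof.
move=> oO cw test r0 BO BF.
have pF := BF p (cBxx p (ltW r0)).
have F0 : 0 <= F by apply: le_trans pF.
have fr : 0 <= 2 * F / r by rewrite divr_ge0 ?mulr_ge0// ltW.
apply: (ball_cone_bound oO cw r0 BO (c := 1)).
- by move=> x phi /BO; exact: test.
- by rewrite ler01 lerDr.
- move=> y /BF yF; rewrite mulrDl mul1r divfK ?gt_eqF//.
  by move: pF yF; rewrite !ler_norml => /andP[? ?] /andP[? ?]; lra.
Qed.

Lemma comparison (n_gt0 : (0 < n)%N) O D u v : open O ->
  (exists M, forall x, O x -> enorm x <= M) ->
  C0 O u -> C0 O v -> sub_test O D u -> super_test O D v ->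
  closure (interior D) = closure D ->
  (forall e, 0 < e -> compact [set x | O x /\ e <= u x - v x]) ->
  forall x, O x -> u x <= v x.
Proof.
move=> oO [M OM] cu cv su sv Dreg cpt x0 Ox0.
rewrite leNgt; apply/negP => uv0.
pose a := u x0 - v x0; have a0 : 0 < a by rewrite subr_gt0.
pose w x := - v x.
have cw : C0 O w by move=> x /cv cvx; exact: continuousN.
pose K (k : R) := [set x | O x /\ a * k <= u x - v x].
have cK k : 0 < k -> compact (K k) by move=> k0; apply/cpt/mulr_gt0.
have KO k x : K k x -> O x by case.
(* Superlevel sets of [u - v] serve as nested compact neighbourhoods. *)
have nest k k' : 0 < k -> k' < k -> exists2 r, 0 < r & forall x, K k x -> cB x r `<=` K k'.
  move=> k0 k'k.
  have [||r r0 rP] := @compact_dist _ _ (K k) (interior (K k')) (cK k k0).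
  - exact: open_interior.
  - move=> x [Ox ax]; apply/nbhs_cBP.
    have /continuous_cBP H : {for x, continuous (fun x => u x - v x)}.
      by apply: continuousB; [exact: cu | exact: cv].
    have e0 : 0 < a * k - a * k' by rewrite subr_gt0 ltr_pM2l.
    have [d d0 dP] := H _ e0; have [d' d'0 d'P] := open_cBP oO Ox.
    exists (Num.min d d'); first by rewrite lt_min d0.
    move=> y yx; split.
      by apply/d'P/(cB_le _ yx); rewrite ge_min lexx orbT.
    have /dP : cB x d y by apply: (cB_le _ yx); rewrite ge_min lexx.
    by rewrite ler_norml => /andP[+ _]; lra.
  - by exists r => // x /rP h; apply: subset_trans h _; exact: interior_subset.
have q16 : (0 : R) < 1/16 by lra.
have q4 : (0 : R) < 1/4 by lra.
have q8 : (0 : R) < 1/8 by lra.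
have q2 : (0 : R) < 1/2 by lra.
have q42 : (1/4 : R) < 1/2 by lra.
have q84 : (1/8 : R) < 1/4 by lra.
have q168 : (1/16 : R) < 1/8 by lra.
have Kle k k' x : k' <= k -> K k x -> K k' x.
  move=> kk' [Ox h]; split=> //; apply: le_trans h.
  by rewrite ler_wpM2l// ltW.
(* Roles of the levels: steps start in [K (1/2)], the sum is maximized over [K (1/4)], Lipschitz
   bounds hold at points of [K (1/8)], and [F] bounds the functions on [K (1/16)]. *)
have [r1 r10 K1] := nest _ _ q2 q42.
have [r2 r20 K2] := nest _ _ q4 q84.
have [r3 r30 K3] := nest _ _ q8 q168.
pose r := Num.min r1 (Num.min r2 r3).
have r0 : 0 < r by rewrite !lt_min r10 r20.
have [rr1 rr2 rr3] : [/\ r <= r1, r <= r2 & r <= r3].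
  by have : r <= r by []; rewrite {2}/r !le_min => /and3P[].
clearbody r.
have [F [F0 uF wF]] : exists F, [/\ 0 < F, forall x, K (1/16) x -> `|u x| <= F &
    forall x, K (1/16) x -> `|w x| <= F].
  have c16 := cK _ q16.
  have [Fu Fu0 uF] := compact_bound c16 (fun x Kx => cu x (KO _ _ Kx)).
  have [Fw Fw0 wF] := compact_bound c16 (fun x Kx => cw x (KO _ _ Kx)).
  exists (Fu + Fw); split; first exact: addr_gt0.
    by move=> x /uF h; apply: le_trans h _; rewrite lerDl ltW.
  by move=> x /wF h; apply: le_trans h _; rewrite lerDr ltW.
have tu0 : slope_test O O 0 u by exact: sub_slope_test su.
have tu : slope_test O O 1 u.
  by move=> x phi Ox c2 /(tu0 _ _ Ox c2)[|h]; [left | right; lra].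
have ind_le1 x : \1_(closure D) x <= 1 :> R.
  by rewrite indicE; case: (_ \in _) => //=; rewrite ler01.
have tw : slope_test O O 1 w by apply: (super_slope_test oO) sv.
pose L := 2 * F / r + 1.
have L0 : 1 <= L by rewrite lerDr divr_ge0 ?mulr_ge0 ?ltW.
have L00 : 0 < L by apply: lt_le_trans L0.
have lip (f : 'rV[R]_n -> R) : C0 O f -> slope_test O O 1 f ->
    (forall x, K (1/16) x -> `|f x| <= F) ->
    forall p q, K (1/8) p -> cB p r q -> f q <= f p + L * enorm (q - p).
  move=> cf tf fF p q Kp; have B16 : cB p r `<=` K (1/16).
    by move=> y yp; apply: (K3 _ Kp); exact: cB_le yp.
  apply: (slope_test_lipschitz oO cf tf r0); first by move=> y /B16/KO.
  by move=> y /B16/fF.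
clearbody L.
have ulip := lip _ cu tu uF; have wlip := lip _ cw tw wF.
(* The term [th * u] then stays within [a / 8], so the rescaling cannot move the maximum out of
   [K (1/2)]. *)
pose th := Num.min 1 (a / (8 * F)).
have th0 : 0 < th by rewrite lt_min ltr01 divr_gt0// mulr_gt0.
have [th1 thF] : th <= 1 /\ th * F <= a / 8.
  have : th <= th by []; rewrite {2}/th le_min => /andP[-> h]; split=> //.
  by move: h; rewrite ler_pdivlMr ?mulr_gt0//; lra.
clearbody th.
have thp : 0 < 1 + th by rewrite addr_gt0.
(* Equivalent to [N + 2 <= (1 + th) * (N - 2 * L)]: the factor [1 + th] recovers the two steps and
   the [2 * L] lost in reaching [closure D]. *)
have [N Nbig] : exists N : nat, (1 + th) * (2 + 2 * L) / th < N.+2%:R.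
  exists (Num.truncn ((1 + th) * (2 + 2 * L) / th)).
  apply: lt_le_trans (truncnS_gt _) _; by rewrite ler_nat.
have {}Nbig : (1 + th) * (2 + 2 * L) <= th * N.+2%:R.
  by move: Nbig; rewrite ltr_pdivrMr// => /ltW; rewrite [th * _]mulrC.
pose N3 : R := N.+3%:R; have N30 : 0 < N3 by rewrite ltr0n.
have N2E : N.+2%:R = N3 - 1 by rewrite /N3 [in RHS]mulrSr addrK.
(* The largest radius in use is [s + e], that is [N3 * e]; it must fit into [r] and change the
   functions by at most [a / 16]. *)
pose e := Num.min (r / N3) (a / (16 * L * N3)).
have e0 : 0 < e by rewrite lt_min !divr_gt0// !mulr_gt0.
have [er eL] : N3 * e <= r /\ 16 * L * (N3 * e) <= a.
  have : e <= e by []; rewrite {2}/e le_min => /andP[].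
  by rewrite !ler_pdivlMr ?mulr_gt0// => ? ?; split; lra.
clearbody e.
pose s := N.+2%:R * e.
have sE : s = N3 * e - e by rewrite /s N2E mulrBl mul1r.
have N33 : 3 <= N3 by rewrite ler_nat.
have e3 : 3 * e <= N3 * e by rewrite ler_pM2r.
have s0 : 0 <= s by rewrite mulr_ge0 ?ltW.
have [er1 se sr] : [/\ e <= r, s + e <= r & s <= r] by clear - sE er e3 e0; split; lra.
have ee : e + e <= r by clear - er e3 e0; lra.
have ser : s <= N3 * e by clear - sE e0; lra.
have eN : e <= N3 * e by clear - e3 e0; lra.
pose U x := (1 + th) * bmax u s x.
pose W x := bmax w e x.
have B48 x t : K (1/4) x -> t <= r -> cB x t `<=` K (1/8).
  by move=> Kx tr y yx; apply: (K2 _ Kx); exact: cB_le (le_trans tr rr2) _ yx.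
have B4O x t : K (1/4) x -> t <= r -> cB x t `<=` O.
  by move=> Kx tr y /(B48 _ _ Kx tr)/KO.
have cbm (f : 'rV[R]_n -> R) t x : C0 O f -> slope_test O O 1 f ->
    (forall x, K (1/16) x -> `|f x| <= F) -> 0 <= t -> t + e <= r ->
    K (1/4) x -> {for x, continuous (bmax f t)}.
  move=> cf tf fF t0 te Kx.
  apply: (bmax_continuous cf t0 e0 L00 (A := K (1/8))); first by move=> y /KO.
    exact: B48.
  move=> p q Kp _ qp; by apply: (lip _ cf tf fF _ _ Kp); exact: cB_le er1 _ qp.
have bm_lip (f : 'rV[R]_n -> R) t x : C0 O f -> slope_test O O 1 f ->
    (forall x, K (1/16) x -> `|f x| <= F) -> 0 <= t -> t <= r ->
    K (1/4) x -> f x <= bmax f t x <= f x + L * t.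
  move=> cf tf fF t0 tr Kx; apply/andP; split.
    by apply: (bmax_ge cf); [exact: B4O | exact: cBxx].
  apply: (bmax_le cf t0); first exact: B4O.
  move=> y yx; apply: (@le_trans _ _ (f x + L * enorm (y - x))).
    apply: (lip _ cf tf fF); last exact: (cB_le tr).
    by apply: (B48 x 0 Kx (ltW r0)); exact: cBxx.
  by rewrite lerD2l ler_pM2l.
apply: (@discrete_comparison R n n_gt0 U W (K (1/4)) (K (1/2)) e x0) => //.
- exact: cK.
- move=> x Kx; apply: continuousM; first exact: cst_continuous.
  exact: cbm.
- by move=> x Kx; apply: cbm => //; exact: ltW.
- by split=> //; rewrite -/a; clear - a0; lra.
- by exists M => x [/OM].
- by move=> x Kx y yx; apply: (K1 _ Kx); exact: cB_le (le_trans er1 rr1) _ yx.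
(* Here [u - v] is below [a / 2]; the radii add at most [3 * a / 16] and [th] at most [a / 8], while
   the sum at [x0] is at least [a - a / 8]. *)
- move=> x Kx; rewrite /K/= not_andP => -[|/negP]; first by case: Kx.
  rewrite -ltNge => ax.
  have Kx0 : K (1/4) x0 by split=> //; rewrite -/a; clear - a0; lra.
  have K416 y : K (1/4) y -> K (1/16) y.
    by apply: Kle; apply: ltW; apply: lt_trans q84.
  have /andP[_ Ux] := @bm_lip u s x cu tu uF s0 sr Kx.
  have /andP[Ux0 _] := @bm_lip u s x0 cu tu uF s0 sr Kx0.
  have /andP[_ Wx] := @bm_lip w e x cw tw wF (ltW e0) er1 Kx.
  have /andP[Wx0 _] := @bm_lip w e x0 cw tw wF (ltW e0) er1 Kx0.
  rewrite /U /W.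
  have h1 : (1 + th) * bmax u s x <= (1 + th) * (u x + L * s) by rewrite ler_pM2l.
  have h2 : (1 + th) * u x0 <= (1 + th) * bmax u s x0 by rewrite ler_pM2l.
  have h3 : th * (L * s) <= 1 * (L * s) by rewrite ler_wpM2r// mulr_ge0// ltW.
  have h4 : L * s <= L * (N3 * e) by rewrite ler_pM2l.
  have h5 : L * e <= L * (N3 * e) by rewrite ler_pM2l.
  have h6 : th * u x <= th * F.
    by rewrite ler_pM2l//; have := uF _ (K416 _ Kx); rewrite ler_norml => /andP[].
  have h7 : th * - F <= th * u x0.
    by rewrite ler_pM2l//; have := uF _ (K416 _ Kx0); rewrite ler_norml => /andP[].
  have aE : a = u x0 - v x0 by [].
  move: Wx Wx0; rewrite /w.
  clear - a0 h1 h2 h3 h4 h5 h6 h7 aE ax eL thF; lra.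
- move=> x Kx.
  have Kx4 : K (1/4) x by apply: Kle Kx; exact: ltW.
  pose A k := bmax u (k%:R * e) x.
  have AO k : (k <= N.+3)%N -> cB x (k%:R * e) `<=` O.
    move=> kN; apply: (B4O _ _ Kx4); apply: le_trans er.
    by rewrite ler_pM2r// ler_nat.
  have Aconv k : (k < N.+2)%N -> 2 * A k.+1 <= A k + A k.+2.
    move=> kN; have := @bmax_convex _ _ O u (k%:R * e) e x oO cu tu0 _ e0.
    have -> : k%:R * e + e = k.+1%:R * e by rewrite mulrSr mulrDl mul1r.
    have -> : k%:R * e + (e + e) = k.+2%:R * e by rewrite !mulrSr !mulrDl mul1r addrA.
    by apply; [rewrite mulr_ge0// ltW | exact: AO].
  (* [U] is shifted by [N.+2] steps, [W] by one. *)
  exists ((1 + th) * (A N.+3 - A N.+2)), ((1 + th) * (A N.+2 - A N.+1)).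
  exists (bmax w (e + e) x - bmax w e x), (bmax w e x - w x).
  have seE : s + e = N.+3%:R * e by rewrite sE -/N3 subrK.
  have seE' : e + s = N.+3%:R * e by rewrite addrC.
  have eO : cB x (e + e) `<=` O by exact: B4O.
  have mono t t' : 0 <= t -> t <= t' -> t' <= r -> bmax u t x <= bmax u t' x.
    move=> t0 tt' t'r; apply: (bmax_sub cu t0); first exact: B4O.
    exact: cB_le.
  have monow t t' : 0 <= t -> t <= t' -> t' <= r -> bmax w t x <= bmax w t' x.
    move=> t0 tt' t'r; apply: (bmax_sub cw t0); first exact: B4O.
    exact: cB_le.
  have w0E : bmax w 0 x = w x by apply: (bmax0 cw); case: Kx4.
  have A0E : A 0%N = u x by rewrite /A mul0r; apply: (bmax0 cu); case: Kx4.
  split; split.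
  + have := @bmax_semigroup _ _ O u s e x cu s0 (ltW e0); rewrite seE' => /(_ (AO _ (leqnn _))).
    move=> [y yx yE]; exists y => //.
    by rewrite /U yE -/(A N.+3) -/(A N.+2); ring.
  + move=> y yx; rewrite /U -/(A N.+2).
    have -> : (1 + th) * A N.+2 - (1 + th) * (A N.+2 - A N.+1) = (1 + th) * A N.+1 by ring.
    rewrite ler_pM2l//; apply: (bmax_sub cu); first by rewrite mulr_ge0// ltW.
      move=> z /(cB_trans yx); rewrite seE'; exact: AO.
    have -> : s = N.+1%:R * e + e by rewrite /s [N.+2%:R]mulrSr mulrDl mul1r.
    by move=> z zx; have := cB_trans (cB_sym yx) zx; rewrite addrC.
  + have [y yx yE] := bmax_semigroup cw (ltW e0) (ltW e0) eO.
    by exists y => //; rewrite /W yE; ring.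
  + move=> y yx; rewrite /W opprB addrC subrK.
    apply: (bmax_ge cw); last exact: cB_sym.
    by move=> z /(cB_trans yx)/eO.
  + rewrite mulr_ge0 ?(ltW thp)// subr_ge0; apply: mono.
    * by rewrite mulr_ge0// ltW.
    * by rewrite ler_pM2r// ler_nat.
    * exact: er.
  + by rewrite ler_pM2l//; have := Aconv N.+1 (ltnSn _); clear; lra.
  + have Bp0 : bmax w e x <= bmax w (e + e) x by apply: monow => //; [exact: ltW | rewrite lerDl ltW].
    (* If the ball of radius [2 e] misses [closure D], the test for [w] holds with [c = 0] and the
       increments are ordered; otherwise [u] must supply slope one. *)
    have [[k Dk kx]|noD] := pselect (exists2 k, closure D k & cB x (e + e) k).
      have B1 := bmax_half oO cw e0 eO (fun y phi yx => tw y phi (eO _ yx)) ler01.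
      have [h|h] := lerP (bmax w e x - w x) (bmax w (e + e) x - bmax w e x); first by left.
      right; move: B1; rewrite le_max mul1r => /orP[h'|h']; first by clear - h h'; lra.
      split=> //.
      have kK8 : K (1/8) k by apply: (B48 _ _ Kx4 ee).
      have NeE : s = N%:R * e + (e + e) by rewrite /s !mulrSr !mulrDl mul1r addrA.
      have N0 : 0 <= N%:R * e by rewrite mulr_ge0// ltW.
      have kB : cB k (N%:R * e) `<=` cB x s.
        by move=> z /(cB_trans kx); rewrite addrC -NeE.
      have sO : cB x s `<=` O by apply: AO.
      have uk : u k + N%:R * e <= bmax u s x.
        (* [N] may be zero, whereas [sub_slope_ge1] asks for a positive radius. *)
        have [NE0|Npos] := leP (N%:R * e) 0.
          have := bmax_ge cu sO (kB _ (cBxx _ N0)); clear - NE0; lra.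
        apply/ler_addgt0Pr => e' e'0.
        have [y yk yu] := sub_slope_ge1 oO cu su Dreg Dk Npos (fun z zk => sO _ (kB _ zk)) e'0.
        have := bmax_ge cu sO (kB _ yk); clear - yu; lra.
      have ux : u x <= u k + L * (e + e).
        apply: le_trans (ulip k x kK8 _) _.
          by apply: (cB_le ee); exact: cB_sym.
        by rewrite lerD2l ler_pM2l//; have := cB_sym kx.
      have := convex_slope Aconv; rewrite A0E.
      have -> : A N.+2 = bmax u s x by [].
      set X := bmax u s x in uk *; set Y := A N.+3 => cs.
      (* Through [k], the rise of [u] from [x] to radius [s] is at least [(N - 2 * L) * e]; the
         choice of [N] turns this into a mean rise of [e] per step after scaling, and [convex_slope]
         passes it to the last step. *)
      have key : N.+2%:R * e <= (1 + th) * (X - u x).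
        have hX : (N%:R - 2 * L) * e <= X - u x by clear - uk ux; lra.
        have : (1 + th) * ((N%:R - 2 * L) * e) <= (1 + th) * (X - u x) by rewrite ler_pM2l.
        move=> hX2; apply: le_trans hX2; rewrite mulrA ler_pM2r//.
        have N2 : N.+2%:R = N%:R + 2 :> R by rewrite -addn2 natrD.
        by rewrite N2 in Nbig *; clear - Nbig; lra.
      have N2p : 0 < N.+2%:R :> R by rewrite ltr0n.
      rewrite -(ler_pM2l N2p); apply: le_trans key _.
      by rewrite mulrCA ler_pM2l.
    left.
    have test0 : slope_test O (cB x (e + e)) 0 w.
      apply: (super_slope_test oO eO) sv => y yx.
      rewrite indicE memNset// => Dy; apply: noD; by exists y.
    have := bmax_half oO cw e0 eO test0 (lexx 0); rewrite mul0r le_max.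
    by move=> /orP[]; clear - Bp0; lra.
Qed.

End Comparison.

(** * Perron's method *)

Section Boundary.
Context {R : realType} {n : nat}.
Implicit Types (x y z : 'rV[R]_n) (O D A G K : set 'rV[R]_n) (f u v w g : 'rV[R]_n -> R).

Lemma bounded_set_enorm O : bounded_set O -> exists M, forall x, O x -> enorm x <= M.
Proof.
move=> [B [_ /(_ (B + 1))]]; rewrite ltrDl ltr01 => /(_ isT) OB.
exists (n%:R * (B + 1)) => x /OB /= xB.
by apply: le_trans (enorm_le_norm x) _; rewrite ler_wpM2l.
Qed.

Lemma within_cBP A z g (l : R) : g x @[x --> within A (nbhs z)] --> l <->
  forall e, 0 < e -> exists2 d, 0 < d & forall y, A y -> cB z d y -> `|g y - l| <= e.
Proof.
split=> [H e e0|H].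
  have /cvgrPdist_le/(_ e e0) := H; rewrite near_withinE => /nbhs_cBP[d d0 dP].
  by exists d => // y Ay /dP/(_ Ay); rewrite distrC.
apply/cvgrPdist_le => e e0; have [d d0 dP] := H e e0.
rewrite near_withinE; apply/nbhs_cBP; exists d => // y zy Ay.
by rewrite distrC; exact: dP.
Qed.

Lemma boundary_notin O z : open O -> boundary O z -> ~ O z.
Proof. by move=> oO [_ nz] Oz; apply: nz; exact: open_nbhs_nbhs. Qed.

Lemma in_boundary O z : closure O z -> ~ O z -> boundary O z.
Proof. by move=> cz nz; split=> // /interior_subset. Qed.

Lemma compact_boundary O M : (forall x, O x -> enorm x <= M) -> compact (boundary O).
Proof.
move=> OM; apply: (@compact_cBP _ _ _ 0 M); first last.
  move=> x [cx _]; rewrite /cB/= subr0; apply/ler_addgt0Pr => e e0.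
  have [y Oy yx] := iffLR (closure_cBP _ _) cx _ e0.
  have := enorm_tri y x 0; rewrite !subr0 (enormB x y).
  by have := OM _ Oy; move: yx; rewrite /cB/=; lra.
by apply: closedI; [exact: closed_closure | apply: open_closedC; exact: open_interior].
Qed.

(* A point of the closure with maximal first coordinate. *)
Lemma boundary_nonempty (n_gt0 : (0 < n)%N) O M : open O ->
  (forall x, O x -> enorm x <= M) -> O !=set0 -> boundary O !=set0.
Proof.
move=> oO OM [x0 Ox0]; pose i0 := Ordinal n_gt0.
have cc : compact (closure O).
  apply: (@compact_cBP _ _ _ 0 M); first exact: closed_closure.
  move=> x cx; rewrite /cB/= subr0; apply/ler_addgt0Pr => e e0.
  have [y Oy yx] := iffLR (closure_cBP _ _) cx _ e0.
  have := enorm_tri y x 0; rewrite !subr0 (enormB x y).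
  by have := OM _ Oy; move: yx; rewrite /cB/=; lra.
have [||z cz zmax] := @compact_argmax _ _ _ (fun x => x ord0 i0 : R) cc.
- by exists x0; exact: subset_closure.
- by move=> x _; exact: coord_continuous.
exists z; apply: in_boundary => // Oz.
have [d d0 dP] := open_cBP oO Oz.
have : O (z + d *: delta_mx ord0 i0).
  apply: dP; rewrite /cB/= addrAC subrr add0r enormZ (ger0_norm (ltW d0)).
  rewrite (_ : enorm _ = 1) ?mulr1//.
  rewrite /enorm (bigD1 i0)//= big1 => [|j ji]; first by rewrite mxE !eqxx expr1n addr0 sqrtr1.
  by rewrite mxE eqxx (negPf ji) expr0n.
by move=> /subset_closure/zmax; rewrite !mxE !eqxx mulr1; lra.
Qed.

(** A limit point outside [O] would be a boundary point, near which [g] is at most [e / 2]. *)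
Lemma superlevel_compact O g M : open O -> (forall x, O x -> enorm x <= M) -> C0 O g ->
  (forall z, boundary O z -> forall e, 0 < e ->
     exists2 d, 0 < d & forall y, O y -> cB z d y -> g y <= e) ->
  forall e, 0 < e -> compact [set x | O x /\ e <= g x].
Proof.
move=> oO OM cg bg e e0; apply: (@compact_cBP _ _ _ 0 M); last first.
  by move=> x [Ox _]; rewrite /cB/= subr0; exact: OM.
apply: closed_cBP => x H.
have [Ox|nOx] := pselect (O x).
  split=> //; rewrite leNgt; apply/negP => ge.
  have e'0 : 0 < (e - g x) / 2 by lra.
  have /continuous_cBP/(_ _ e'0)[d d0 dP] := cg _ Ox.
  have [y [_ ey] /dP] := H _ d0; rewrite ler_norml => /andP[_]; lra.
have bx : boundary O x.
  apply: in_boundary => //; apply/closure_cBP => r /H[y [Oy _] yx].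
  by exists y.
have e2 : 0 < e / 2 by lra.
have [d d0 dP] := bg _ bx _ e2.
by have [y [Oy ey] /(dP _ Oy)] := H _ d0; lra.
Qed.

Lemma C0_within O u : open O -> {within O, continuous u} <-> C0 O u.
Proof.
move=> oO; rewrite continuous_open_subspace//; split.
  by move=> H x Ox; apply: H; rewrite inE.
by move=> H x; rewrite inE => /H.
Qed.

Lemma C0_lsc_on O u : open O -> C0 O u -> lsc_on O u.
Proof.
move=> oO /(C0_within _ oO) cu x a; rewrite lte_fin => au.
have /cvgrPdist_lt/(_ (u x - a)) := cu x; rewrite subr_gt0 => /(_ au) near_x.
exists [set y | `|u x - u y| < u x - a] => //.
move=> y /=; rewrite ltr_norml lte_fin => /andP[_]; lra.
Qed.

Lemma C0_usc_on O u : open O -> C0 O u -> usc_on O u.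
Proof. by move=> oO cu; apply: C0_lsc_on => // x /cu cux; exact: continuousN. Qed.

Lemma C0_sum O m (g : 'I_m -> 'rV[R]_n -> R) : (forall i, C0 O (g i)) ->
  C0 O (fun x => \sum_(i < m) g i x).
Proof.
move=> cg x Ox.
have -> : (fun x => \sum_(i < m) g i x) = \sum_(i < m) g i.
  by apply/funext => y; rewrite fct_sumE.
elim/big_ind : _ => [|g1 g2 c1 c2|i _].
- exact: cst_continuous.
- exact: continuousD.
- exact: cg.
Qed.

Lemma C0_infinity_laplacian O phi : C2 O phi -> C0 O (infinity_laplacian phi).
Proof.
move=> c; apply: C0_sum => i; apply: C0_sum => j x Ox.
apply: continuousM; first (apply: continuousM; first exact: C2_C0_partial2 c _ Ox).
  exact: C2_C0_partial c _ Ox.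
exact: C2_C0_partial c _ Ox.
Qed.

Lemma C0_gradient_norm O phi : C2 O phi -> C0 O (fun x => enorm (gradient phi x)).
Proof.
move=> c; have cs : C0 O (fun x => \sum_(i < n) partial i phi x * partial i phi x).
  apply: C0_sum => i x Ox.
  by apply: continuousM; exact: C2_C0_partial c _ Ox.
have -> : (fun x => enorm (gradient phi x)) =
    Num.sqrt \o (fun x => \sum_(i < n) partial i phi x * partial i phi x).
  apply/funext => x /=; congr Num.sqrt; apply: eq_bigr => i _.
  by rewrite gradientE expr2.
move=> x Ox; apply: continuous_comp; first exact: cs.
exact: sqrt_continuous.
Qed.

Lemma C0_max O u v : C0 O u -> C0 O v -> C0 O (fun x => Num.max (u x) (v x)).
Proof. by move=> cu cv x Ox; apply: continuous_max; [exact: cu | exact: cv]. Qed.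

End Boundary.

(** * The supremum of continuous subsolutions below the boundary data *)

Section Perron.
Context {R : realType} {n : nat}.
Implicit Types (x y z : 'rV[R]_n) (u v w g phi : 'rV[R]_n -> R).
Variables (O D : set 'rV[R]_n) (f : 'rV[R]_n -> R) (M F : R).
Hypothesis oO : open O.
Hypothesis OM : forall x, O x -> enorm x <= M.
Hypothesis fF : forall z, boundary O z -> `|f z| <= F.
Hypothesis cf : forall z, boundary O z -> forall e, 0 < e ->
  exists2 d, 0 < d & forall y, boundary O y -> cB z d y -> `|f y - f z| <= e.
Variable z0 : 'rV[R]_n.
Hypothesis bz0 : boundary O z0.

(** The last clause says that the upper limit of [u] at [z] is at most [f z]. It is one-sided; the
    barriers make the supremum attain the data. *)
Definition perron_class : set ('rV[R]_n -> R) := [set u |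
  [/\ C0 O u, sub_test O D u & forall z, boundary O z -> forall e, 0 < e ->
    exists2 d, 0 < d & forall y, O y -> cB z d y -> u y <= f z + e]].

Definition perron x : R := sup [set u x | u in perron_class].

(** Within distance [d] continuity of [f] gives [e]; farther away [2 * F] is at most [2 * F / d]
    times the distance. The summand 1 gives lower barriers the slope that the gradient constraint
    demands. *)
Lemma boundary_cone z (e : R) : boundary O z -> 0 < e -> exists2 C, 1 <= C &
  forall y, boundary O y -> `|f y - f z| <= e + C * enorm (y - z).
Proof.
move=> bz e0; have [d d0 dP] := cf bz e0.
have F0 : 0 <= F by apply: le_trans (fF bz).
exists (1 + 2 * F / d); first by rewrite lerDl divr_ge0 ?mulr_ge0// ltW.
move=> y by_; have q0 := enorm_ge0 (y - z).
have Fd0 : 0 <= 2 * F / d * enorm (y - z).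
  by rewrite mulr_ge0// divr_ge0 ?mulr_ge0// ltW.
have [yd|yd] := lerP (enorm (y - z)) d.
  by apply: le_trans (dP _ by_ yd) _; rewrite mulrDl mul1r; lra.
have h : 2 * F <= 2 * F / d * enorm (y - z).
  by rewrite mulrAC ler_pdivlMr// ler_wpM2l ?mulr_ge0// ltW.
have := ler_normB (f y) (f z); have := fF by_; have := fF bz.
by rewrite mulrDl mul1r; lra.
Qed.

(** If [u] exceeded the cone at [x], the set where the excess is at least half of that at [x] would
    be compact in [O]; comparison there with the cone raised by this half is contradictory. *)
Lemma perron_class_cone_le z (a C : R) u : ~ O z -> 0 <= C ->
  (forall y, boundary O y -> f y <= a + C * enorm (y - z)) ->
  perron_class u -> forall x, O x -> u x <= a + C * enorm (x - z).
Proof.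
move=> nz C0' fle [cu su bu] x Ox; rewrite leNgt; apply/negP => ux.
pose g y := u y - (a + C * enorm (y - z)).
have ccone y : {for y, continuous (fun y : 'rV[R]_n => a + C * enorm (y - z))}.
  apply: continuousD; first exact: cst_continuous.
  by apply: continuousM; [exact: cst_continuous | exact: enormB_continuous].
have cg : C0 O g by move=> y Oy; apply: continuousB; [exact: cu | exact: ccone].
pose e := g x / 2; have e0 : 0 < e by rewrite divr_gt0// subr_gt0.
have cK : compact [set y | O y /\ e <= g y].
  apply: (superlevel_compact oO OM cg) => // z' bz' e' e'0.
  have e'2 : 0 < e' / 2 by lra.
  have [d d0 dP] := bu _ bz' _ e'2.
  have /continuous_cBP/(_ _ e'2)[d' d'0 d'P] := ccone z'.
  exists (Num.min d d'); first by rewrite lt_min d0.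
  move=> y Oy; rewrite /cB/= le_min => /andP[/(dP _ Oy) h /d'P].
  rewrite ler_norml => /andP[+ _]; rewrite /g.
  by have := fle _ bz'; lra.
have oN : open [set y | O y /\ e < g y].
  rewrite openE => y [Oy ey]; apply/nbhs_cBP.
  have e'0 : 0 < (g y - e) / 2 by lra.
  have /continuous_cBP/(_ _ e'0)[d d0 dP] := cg _ Oy.
  have [d' d'0 d'P] := open_cBP oO Oy.
  exists (Num.min d d'); first by rewrite lt_min d0.
  move=> y'; rewrite /cB/= le_min => /andP[/dP h /d'P Oy']; split=> //.
  by move: h; rewrite ler_norml => /andP[+ _]; lra.
have := @cone_comparison _ _ O _ _ u (a + e) C 0 z oO cK _ cu oN.
have gx0 : 0 < g x by rewrite /g subr_gt0.
have exg : e <= g x by rewrite /e; lra.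
move=> /(_ _ _ _ _ _ _ x (conj Ox exg)) H.
suff : u x <= a + e + C * enorm (x - z) by move: gx0; rewrite /e /g; lra.
apply: H.
- by move=> y [].
- by move=> y [Oy /ltW].
- by case.
- by apply: sub_slope_test su => y [].
- by rewrite lexx.
- move=> y [Oy _] /not_andP[//|/negP]; rewrite -leNgt /g; lra.
Qed.

(** Off its vertex the cone is infinity harmonic with gradient of length [C], so [C >= 1] satisfies
    the constraint wherever [D] lies. *)
Lemma perron_class_cone z (a C : R) : ~ O z -> 1 <= C ->
  (forall y, boundary O y -> a - C * enorm (y - z) <= f y) ->
  perron_class (fun x => a - C * enorm (x - z)).
Proof.
move=> nz C1 fge.
have pos y : O y -> 0 < sqnorm (y - z) + 0.
  move=> Oy; rewrite addr0 -enorm_sq exprn_gt0// enorm_gt0// subr_eq0.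
  by apply: contra_notN nz => /eqP <-.
have [c2 gE lE] := cone_funP a (- C) 0 oO pos.
have coneE : cone_fun a (- C) 0 0 z = (fun x => a - C * enorm (x - z)).
  by apply/funext => x; rewrite /cone_fun addr0 mul0r subr0 mulNr.
rewrite coneE in c2 gE lE.
split; first exact: C2_C0 c2.
- move=> x phi Ox cphi xmax.
  have [gphi lphi] := local_max_classical oO c2 cphi Ox xmax.
  split.
    by apply: le_trans lphi; rewrite lE// !mulr0 mul0r !subr0 mulr0.
  rewrite -gphi gE// mulr0 subr0 addr0 -/(enorm (x - z)).
  have q0 : 0 < enorm (x - z).
    by rewrite enorm_gt0// subr_eq0; apply: contra_notN nz => /eqP <-.
  rewrite normrM normrN normfV (ger0_norm (ltW q0)) divfK ?gt_eqF//.
  rewrite ger0_norm; last by lra.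
  by rewrite indicE; case: (_ \in _) => /=; lra.
- move=> z' bz' e e0.
  have /continuous_cBP/(_ _ e0)[d d0 dP] : {for z', continuous (fun x => a - C * enorm (x - z))}.
    apply: continuousB; first exact: cst_continuous.
    by apply: continuousM; [exact: cst_continuous | exact: enormB_continuous].
  exists d => // y _ /dP; rewrite ler_norml => /andP[_].
  by have := fge _ bz'; lra.
Qed.

Lemma boundary_barriers z (e : R) : boundary O z -> 0 < e -> exists2 C, 1 <= C &
  (forall u, perron_class u -> forall x, O x -> u x <= f z + e + C * enorm (x - z)) /\
  perron_class (fun x => f z - e - C * enorm (x - z)).
Proof.
move=> bz e0; have [C C1 CP] := boundary_cone bz e0.
have nz := boundary_notin oO bz; have C00 : 0 <= C by lra.
exists C => //; split.
  move=> u; apply: perron_class_cone_le => // y /CP.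
  by rewrite ler_norml => /andP[_]; lra.
apply: perron_class_cone => // y /CP.
by rewrite ler_norml => /andP[+ _]; lra.
Qed.

(** The boundary point [z0] provides both a member of the class and an upper bound. *)
Lemma perron_has_sup x : O x -> has_sup [set u x | u in perron_class].
Proof.
move=> Ox; have [C C1 [up low]] := boundary_barriers bz0 ltr01.
split; first by eexists; exists (fun x => f z0 - 1 - C * enorm (x - z0)).
by exists (f z0 + 1 + C * enorm (x - z0)) => _ [u /up + <-]; exact.
Qed.

Lemma perron_ge u x : perron_class u -> O x -> u x <= perron x.
Proof.
move=> Pu Ox; apply: sup_upper_bound; first exact: perron_has_sup.
by exists u.
Qed.

Lemma perron_le x (a : R) : O x -> (forall u, perron_class u -> u x <= a) -> perron x <= a.
Proof.
move=> Ox H; apply: ge_sup; first by have [] := perron_has_sup Ox.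
by move=> _ [u /H + <-].
Qed.

Lemma perron_barriers z (e : R) : boundary O z -> 0 < e -> exists2 C, 1 <= C &
  forall x, O x -> `|perron x - f z| <= e + C * enorm (x - z).
Proof.
move=> bz e0; have [C C1 [up low]] := boundary_barriers bz e0.
exists C => // x Ox; rewrite ler_norml; apply/andP; split.
  by have := perron_ge low Ox; lra.
have : perron x <= f z + e + C * enorm (x - z).
  by apply: perron_le => // u /up; exact.
by lra.
Qed.

Lemma perron_limit z (e : R) : boundary O z -> 0 < e ->
  exists2 d, 0 < d & forall y, O y -> cB z d y -> `|perron y - f z| <= e.
Proof.
move=> bz e0; have e2 : 0 < e / 2 by lra.
have [C C1 CP] := perron_barriers bz e2.
have C0' : 0 < C by lra.
exists (e / 2 / C); first by rewrite divr_gt0.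
move=> y Oy; rewrite /cB/= ler_pdivlMr// => yz.
by have := CP _ Oy; lra.
Qed.

Lemma perron_bounded : exists2 H, 0 < H & forall x, O x -> `|perron x| <= H.
Proof.
have [C C1 CP] := perron_barriers bz0 ltr01.
have M0 : forall x, O x -> enorm (x - z0) <= `|M| + enorm z0.
  move=> x /OM xM; have := enormD x (- z0); rewrite enormN.
  by have := ler_norm M; lra.
have H0 : 0 <= C * (`|M| + enorm z0) by rewrite mulr_ge0 ?addr_ge0 ?enorm_ge0//; lra.
exists (`|f z0| + 1 + C * (`|M| + enorm z0)); first by have := normr_ge0 (f z0); lra.
move=> x Ox; have := CP x Ox; have := ler_normD (perron x - f z0) (f z0); rewrite subrK.
have : C * enorm (x - z0) <= C * (`|M| + enorm z0) by rewrite ler_pM2l ?M0//; lra.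
by lra.
Qed.

(* [u(y) <= (1 - t) u(x) + t H], [t = |y - x| / r], for every [u] in the class
   below [H]; this passes to the supremum because [1 - t >= 0]. *)
Lemma perron_slope x y (r H : R) : (forall x, O x -> `|perron x| <= H) ->
  0 < r -> cB x r `<=` O -> cB x r y -> perron y <= perron x + 2 * H / r * enorm (y - x).
Proof.
move=> PH r0 BO yx.
have Ox : O x by apply/BO/cBxx/ltW.
have Hup z : O z -> perron z <= H by move=> /PH; rewrite ler_norml => /andP[].
pose t := enorm (y - x) / r.
have t0 : 0 <= t by rewrite divr_ge0 ?enorm_ge0 ?ltW.
have t1 : t <= 1 by rewrite ler_pdivrMr// mul1r.
apply: (@le_trans _ _ ((1 - t) * perron x + t * H)); last first.
  have : t * (H - perron x) <= t * (2 * H).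
    rewrite ler_wpM2l//.
    by have := PH _ Ox; rewrite ler_norml => /andP[+ _]; lra.
  have -> : 2 * H / r * enorm (y - x) = t * (2 * H) by rewrite /t; ring.
  by lra.
apply: perron_le; first exact: BO.
move=> u Pu; have [cu su _] := Pu.
have uH z : cB x r z -> u z <= H.
  by move=> /BO Oz; apply: le_trans (perron_ge Pu Oz) _; exact: Hup.
pose b := (H - u x) / r.
have uxH := uH _ (cBxx x (ltW r0)).
have b0 : (0 : R) <= 0 <= b.
  by rewrite lexx divr_ge0 ?subr_ge0// ltW.
apply: (@le_trans _ _ (u x + b * enorm (y - x))).
  apply: (ball_cone_bound oO cu r0 BO _ b0) => //.
    exact: sub_slope_test su.
  by move=> z /uH; rewrite divfK ?gt_eqF//; lra.
have -> : u x + b * enorm (y - x) = (1 - t) * u x + t * H by rewrite /b /t; ring.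
by rewrite lerD2r ler_wpM2l ?subr_ge0// perron_ge.
Qed.

Lemma perron_C0 : C0 O perron.
Proof.
move=> x Ox; have [H H0 PH] := perron_bounded.
have [r r0 rO] := open_cBP oO Ox.
have r2 : 0 < r / 2 by lra.
pose Q := 2 * H / (r / 2); have Q0 : 0 < Q by rewrite divr_gt0// mulr_gt0.
apply/continuous_cBP => e e0; exists (Num.min (r / 2) (e / Q)).
  by rewrite lt_min r2 divr_gt0.
move=> y; rewrite /cB/= le_min => /andP[yr]; rewrite ler_pdivlMr// => ye.
have h1 := perron_slope PH r2 (fun z zx => rO _ (cB_le (ltac:(lra) : r / 2 <= r) zx)) yr.
have yO : cB y (r / 2) `<=` O.
  move=> z zy; apply: rO; have := cB_trans (yr : cB x (r / 2) y) zy.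
  by have -> : r / 2 + r / 2 = r by lra.
have h2 := perron_slope PH r2 yO (cB_sym (yr : cB x (r / 2) y)).
rewrite (enormB x y) -/Q in h2; rewrite -/Q in h1.
by rewrite ler_norml; lra.
Qed.

Lemma annulus_compact x (r : R) : compact [set y | cB x r y /\ r / 2 <= enorm (y - x)].
Proof.
apply: (compact_superlevel (@compact_cB _ _ x r)) => y _.
exact: enormB_continuous.
Qed.

(** Failure of the test persists near [x]: the derivatives of [phi] are continuous, and the
    constraint can fail only in the open set [interior D]. A member nearly optimal at [x] then
    touches [phi] near [x], because strictness leaves a gap on the annulus. *)
Lemma perron_viscosity_sub : viscosity_subsolution O D perron.
Proof.
split; first exact/C0_usc_on/perron_C0.
move=> x phi Ox c2 xmax; rewrite min_ge0 subr_ge0.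
have [//|bad] := boolP (_ && _).
have [r r0 [rO rmax rbad]] : exists2 r, 0 < r & [/\ cB x r `<=` O,
    forall y, cB x r y -> y <> x -> perron y - phi y < perron x - phi x &
    forall y, cB x r y -> ~ (0 <= infinity_laplacian phi y /\
       \1_(interior D) y <= enorm (gradient phi y))].
  have [r1 r10 r1P] := open_cBP oO Ox.
  have [r2 r20 r2P] := iffLR (nbhs_cBP _ _) xmax.
  have [r3 r30 r3P] : exists2 r, 0 < r & forall y, cB x r y ->
      ~ (0 <= infinity_laplacian phi y /\ \1_(interior D) y <= enorm (gradient phi y)).
    move: bad; rewrite negb_and -!ltNge => /orP[lneg|gneg].
      have l0 : 0 < - infinity_laplacian phi x / 2 by lra.
      have /continuous_cBP/(_ _ l0)[d d0 dP] := C0_infinity_laplacian c2 Ox.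
      by exists d => // y /dP; rewrite ler_norml => /andP[? ?] []; lra.
    have Dx : interior D x.
      apply: contrapT => nD; move: gneg; rewrite indicE memNset//.
      by rewrite ltNge enorm_ge0.
    move: gneg; rewrite indicE mem_set//= => gneg.
    have l0 : 0 < (1 - enorm (gradient phi x)) / 2 by lra.
    have /continuous_cBP/(_ _ l0)[d d0 dP] := C0_gradient_norm c2 Ox.
    have [d' d'0 d'P] := open_cBP (@open_interior _ D) Dx.
    exists (Num.min d d'); first by rewrite lt_min d0.
    move=> y; rewrite /cB/= le_min => /andP[/dP h /d'P Dy] [_].
    move: h; rewrite indicE mem_set// ler_norml => /andP[_] /=; lra.
  exists (Num.min r1 (Num.min r2 r3)); first by rewrite !lt_min r10 r20.
  split=> y; rewrite /cB/= !le_min => /and3P[y1 y2 y3].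
  - exact: r1P.
  - by apply: r2P => //; exact: r1P.
  - exact: r3P.
have cP := perron_C0.
have [|y [yr y2]|d d0 dP] := compact_lt_gap (@annulus_compact x r) (u := fun y => perron y - phi y) (a := perron x - phi x).
- move=> y [/rO Oy _]; apply: continuousB; first exact: cP.
  exact: C2_C0 c2 _ Oy.
- by apply: rmax => // yx; move: y2; rewrite yx subrr enorm0; lra.
have [_ [u Pu <-] ux] := sup_adherent d0 (perron_has_sup Ox).
have [cu su _] := Pu; rewrite -/(perron x) in ux.
have [y1 y1r y1max] : exists2 y1, cB x r y1 & forall y, cB x r y -> u y - phi y <= u y1 - phi y1.
  apply: compact_argmax; first exact: compact_cB.
    by exists x; apply: cBxx; rewrite ltW.
  by move=> y /rO Oy; apply: continuousB; [exact: cu | exact: C2_C0 c2 _ Oy].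
have y12 : enorm (y1 - x) < r / 2.
  rewrite ltNge; apply/negP => h; have := dP y1 (conj y1r h).
  have := perron_ge Pu (rO _ y1r); have := y1max x (cBxx x (ltW r0)).
  lra.
have y1loc : \forall y \near y1, u y - phi y <= u y1 - phi y1.
  apply: filterS (open_nbhs_nbhs (conj (@open_oB _ _ x (r / 2)) y12)) => y /= yr.
  by apply: y1max; rewrite /cB/=; lra.
by have := rbad _ y1r (su _ _ (rO _ y1r) c2 y1loc).
Qed.

Lemma perron_sub_test : sub_test O D perron.
Proof. exact: viscosity_sub_test perron_viscosity_sub. Qed.

(* Lifting the supremum to [phi + c] near a point where [phi] touches it from
   below and satisfies the strict inequalities stays in the class. *)
Lemma perron_bump x (r c : R) phi : O x -> C2 O phi -> 0 < r -> cB x r `<=` O ->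
  (forall y, cB x r y -> 0 <= infinity_laplacian phi y /\
     \1_(interior D) y <= enorm (gradient phi y)) ->
  (forall y, cB x r y -> r / 2 <= enorm (y - x) -> phi y + c <= perron y) ->
  phi x + c <= perron x.
Proof.
move=> Ox c2 r0 rO rphi rann.
pose B := [set y | enorm (y - x) < r].
pose U y := if enorm (y - x) < r then Num.max (perron y) (phi y + c) else perron y.
have UP y : perron y <= U y by rewrite /U; case: ifP => // _; rewrite le_max lexx.
have Uphi y : B y -> phi y + c <= U y by rewrite /B/= /U => ->; rewrite le_max lexx orbT.
suff PU : perron_class U.
  have := perron_ge PU Ox; apply: le_trans; apply: Uphi.
  by rewrite /B/= subrr enorm0.
have oB : open B by exact: open_oB.
(* [A] and [B] overlap and cover the space, and on [O] each carries a continuous formula for [U],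
   since the bump is inactive on the annulus. *)
pose A := [set y | r / 2 < enorm (y - x)].
have oA : open A.
  rewrite openE => y /= yA; apply/nbhs_cBP.
  exists ((enorm (y - x) - r / 2) / 2); first by rewrite /A/= in yA; lra.
  move=> y'; rewrite /cB/= => y'y; have := enorm_tri y' y x; rewrite (enormB y y').
  by rewrite /A/= in yA *; lra.
have UA y : (O `&` A) y -> U y = perron y.
  move=> [Oy Ay]; rewrite /U; case: ifP => // yr.
  by rewrite max_l//; apply: rann; rewrite /cB/= ltW.
have UB y : (O `&` B) y -> U y = Num.max (perron y) (phi y + c).
  by move=> [_]; rewrite /B/= /U => ->.
have cphi : C0 O (fun y => phi y + c).
  move=> y Oy; apply: continuousD; first exact: C2_C0 c2 _ Oy.
  exact: cst_continuous.
have cP := perron_C0.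
have cUA : C0 (O `&` A) U.
  apply: (C0_eq (openI oO oA) UA) => y [Oy _]; exact: cP.
have cUB : C0 (O `&` B) U.
  apply: (C0_eq (openI oO oB) UB) => y [Oy _]; exact: (C0_max cP cphi Oy).
split.
- move=> y Oy; have [yr|yr] := ltP (enorm (y - x)) r.
    exact: cUB.
  by apply: cUA; split=> //; rewrite /A/=; lra.
- move=> y psi Oy cpsi ymax.
  (* A test function touching [U] from above also touches whichever of [perron] and [phi + c]
     realizes [U] at [y]. *)
  have [UE|UE] := eqVneq (U y) (perron y).
    apply: (perron_sub_test Oy cpsi); apply: filterS ymax => y'.
    by rewrite UE; have := UP y'; lra.
  have yB : B y.
    by rewrite /B/=; apply: contraNT UE; rewrite /U => /negPf ->.
  have UE' : U y = phi y + c.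
    move: UE; rewrite (UB _ (conj Oy yB)).
    by have [h|h] := leP (perron y) (phi y + c); rewrite ?eqxx.
  have ymax' : \forall y' \near y, phi y' - psi y' <= phi y - psi y.
    apply: filterS2 ymax (open_nbhs_nbhs (conj oB yB)) => y' h /Uphi.
    by move: h; rewrite UE'; lra.
  have [gE lE] := local_max_classical oO c2 cpsi Oy ymax'.
  have [l0 g1] := rphi y (ltW yB).
  by rewrite -gE; split=> //; apply: le_trans lE.
- move=> z bz e e0.
  have [d d0 dP] := perron_limit bz e0.
  (* The modified ball lies in [O], so near a boundary point [U] is [perron]. *)
  have [d' d'0 d'P] : exists2 d, 0 < d & cB z d `<=` ~` cB x r.
    apply: open_cBP; first exact/closed_openC/closed_cB.
    by move=> /rO; exact: boundary_notin bz.
  exists (Num.min d d'); first by rewrite lt_min d0.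
  move=> y Oy; rewrite /cB/= le_min => /andP[/(dP _ Oy) h /d'P /negP].
  rewrite -ltNge => yr; rewrite /U ltNge (ltW yr)/=.
  by move: h; rewrite ler_norml => /andP[_]; lra.
Qed.

(** Strict failure makes [phi] a classical subsolution near [x]: at a point of [closure D] its
    gradient stays longer than one, and off [closure D] the constraint is void nearby. Strict
    touching leaves room [d] on the annulus, so the bump would raise the supremum at [x]. *)
Lemma perron_viscosity_super : viscosity_supersolution O D perron.
Proof.
split; first exact/C0_lsc_on/perron_C0.
move=> x phi Ox c2 xmin; rewrite leNgt lt_min subr_gt0; apply/negP => /andP[lpos gpos].
have [r r0 [rO rmin rphi]] : exists2 r, 0 < r & [/\ cB x r `<=` O,
    forall y, cB x r y -> y <> x -> perron x - phi x < perron y - phi y &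
    forall y, cB x r y -> 0 <= infinity_laplacian phi y /\
       \1_(interior D) y <= enorm (gradient phi y)].
  have [r1 r10 r1P] := open_cBP oO Ox.
  have [r2 r20 r2P] := iffLR (nbhs_cBP _ _) xmin.
  have l0 : 0 < infinity_laplacian phi x / 2 by lra.
  have /continuous_cBP/(_ _ l0)[r3 r30 r3P] := C0_infinity_laplacian c2 Ox.
  have [r4 r40 r4P] : exists2 r, 0 < r & forall y, cB x r y ->
      \1_(interior D) y <= enorm (gradient phi y).
    have [Dx|Dx] := pselect (closure D x).
      move: gpos; rewrite indicE mem_set//= => gpos.
      have g0 : 0 < enorm (gradient phi x) - 1 by lra.
      have /continuous_cBP/(_ _ g0)[d d0 dP] := C0_gradient_norm c2 Ox.
      exists d; first exact: d0.
      move=> y /dP; rewrite ler_norml => /andP[+ _].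
      by rewrite indicE; case: (_ \in _) => /=; lra.
    have [d d0 dP] := open_cBP (closed_openC (@closed_closure _ D)) Dx.
    exists d; first exact: d0.
    move=> y /dP nD; rewrite indicE memNset ?enorm_ge0// => /interior_subset Dy.
    by apply: nD; exact: subset_closure.
  exists (Num.min r1 (Num.min r2 (Num.min r3 r4))); first by rewrite !lt_min r10 r20 r30.
  split=> y; rewrite /cB/= !le_min => /and4P[y1 y2 y3 y4].
  - exact: r1P.
  - by apply: r2P => //; exact: r1P.
  - split; last exact: r4P.
    by have := r3P _ y3; rewrite ler_norml => /andP[+ _]; lra.
have [|y [yr y2]|d d0 dP] := compact_lt_gap (@annulus_compact x r) (u := fun y => phi y - perron y) (a := phi x - perron x).
- move=> y [/rO Oy _]; apply: continuousB; first exact: C2_C0 c2 _ Oy.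
  exact: perron_C0.
- have yx : y <> x by move=> yx; move: y2; rewrite yx subrr enorm0; lra.
  by have := rmin _ yr yx; lra.
have := @perron_bump x r (perron x - phi x + d) phi Ox c2 r0 rO rphi.
have bd y : cB x r y -> r / 2 <= enorm (y - x) ->
    phi y + (perron x - phi x + d) <= perron y.
  by move=> yr y2; have := dP _ (conj yr y2); lra.
by move=> /(_ bd); lra.
Qed.

Lemma perron_solves : solves_problem O D f perron.
Proof.
split.
  split; [exact/(C0_within _ oO)/perron_C0 | exact: perron_viscosity_sub |
          exact: perron_viscosity_super].
by move=> z bz; apply/within_cBP => e e0; exact: perron_limit.
Qed.

End Perron.

(** * Uniqueness from comparison, and the theorem *)

Section Uniqueness.
Context {R : realType} {n : nat}.

Lemma solves_problem_le (n_gt0 : (0 < n)%N) (O D : set 'rV[R]_n) (f u v : 'rV[R]_n -> R) :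
  bounded_domain O -> closure (interior D) = closure D ->
  solves_problem O D f u -> solves_problem O D f v -> forall x, O x -> u x <= v x.
Proof.
move=> [_ oO _ /bounded_set_enorm[M OM]] Dreg [[cu su _] bu] [[cv _ sv] bv].
have {}cu := iffLR (C0_within _ oO) cu; have {}cv := iffLR (C0_within _ oO) cv.
apply: (comparison n_gt0 oO (ex_intro _ M OM) cu cv _ _ Dreg).
- exact: viscosity_sub_test su.
- exact: viscosity_super_test sv.
apply: (superlevel_compact oO OM).
  by move=> x Ox; apply: continuousB; [exact: cu | exact: cv].
move=> z bz e e0; have e2 : 0 < e / 2 by lra.
have [d d0 dP] := iffLR (within_cBP _ _ _ _) (bu _ bz) _ e2.
have [d' d'0 d'P] := iffLR (within_cBP _ _ _ _) (bv _ bz) _ e2.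
exists (Num.min d d'); first by rewrite lt_min d0.
move=> y Oy; rewrite /cB/= le_min => /andP[/(dP _ Oy) + /(d'P _ Oy)].
by rewrite !ler_norml => /andP[_ ?] /andP[? _]; lra.
Qed.

End Uniqueness.

Theorem theorem4p1 (R : realType) (n : nat) (n_gt0 : (0 < n)%N)
    (Omega : set 'rV[R]_n) (f : 'rV[R]_n -> R) (D : set 'rV[R]_n)
    (Omega_dom : bounded_domain Omega)
    (f_cont : {within boundary Omega, continuous f})
    (D_sub : D `<=` Omega)
    (D_reg : closure (interior D) = closure D) :
  exists u : 'rV[R]_n -> R,
    solves_problem Omega D f u /\
    (forall v : 'rV[R]_n -> R, solves_problem Omega D f v ->
       forall x, Omega x -> v x = u x).
Proof.
have [ne oO _ /bounded_set_enorm[M OM]] := Omega_dom.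
have [z0 bz0] := boundary_nonempty n_gt0 oO OM ne.
have cb := compact_boundary OM.
have [F FP] : exists F, forall z, boundary Omega z -> `|f z| <= F.
  have [B [_ /(_ (B + 1))]] := compact_bounded (continuous_compact f_cont cb).
  rewrite ltrDl ltr01 => /(_ isT) fB.
  by exists (B + 1) => z bz; apply: fB; exists z.
have cf z : boundary Omega z -> forall e, 0 < e -> exists2 d, 0 < d &
    forall y, boundary Omega y -> cB z d y -> `|f y - f z| <= e.
  by move=> bz; apply/within_cBP; move/subspace_continuousP : f_cont; exact.
have sol := perron_solves D oO OM FP cf bz0.
exists (perron Omega D f); split=> // v vsol x Ox; apply/le_anti/andP; split.
  exact: solves_problem_le vsol sol x Ox.
exact: solves_problem_le sol vsol x Ox.
Qed.
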